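(* For any connected conjunctive query $Q$ without self-joins with $|\mathrm{attr}(Q)\setminus\mathrm{head}(Q)|=1$, $\mathrm{SWP}$ is $O(\log N)$-approximable, where $N$ is the input size of the database.
   Context: A conjunctive query (CQ) without self-joins is $Q(\mathbf{A}) :- R_1(\mathbb{A}_1), \ldots, R_m(\mathbb{A}_m)$ with pairwise distinct relation symbols, $\mathrm{attr}(R_i)=\mathbb{A}_i$, $\mathrm{attr}(Q)=\bigcup_i\mathbb{A}_i$, output attributes $\mathrm{head}(Q)=\mathbf{A}$. A database $D$ gives each $R_i$ a finite set of tuples over $\mathbb{A}_i$; $N=|D|$; $Q(D)$ is the projection onto $\mathrm{head}(Q)$ of the natural join. $\mathrm{SWP}(Q,D)$ asks for $D'\subseteq D$ with $Q(D')=Q(D)$ and $|D'|$ minimum. For fixed $Q$, $\mathrm{SWP}$ is $\theta$-approximable if there is an algorithm running in time polynomial in $|D|$ that for every database $D$ outputs $D'\subseteq D$ with $Q(D')=Q(D)$ and $|D'|\le\theta\cdot|D^*|$, $D^*$ a solution to $\mathrm{SWP}(Q,D)$. $Q$ is connected if the graph on its relations with edges between relations sharing an attribute is connected. *)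

(* Defs.v *)
From mathcomp Require Import all_boot.
Set Implicit Arguments. Unset Strict Implicit. Unset Printing Implicit Defensive.

(* Attributes are 'I_a, relation symbols are 'I_m (pairwise distinct, *)
(* hence no self-joins).  schema i = attr(R_i), head = head(Q).       *)

(* A fact of the database: a relation symbol together with a tuple,   *)
(* represented as a function on all attributes that is 0 outside the  *)
(* schema of the relation.                                            *)
Definition fact (a m : nat) := ('I_m * {ffun 'I_a -> nat})%type.

Definition restrict (a : nat) (S : {set 'I_a}) (v : 'I_a -> nat) : {ffun 'I_a -> nat} :=
  [ffun x => if x \in S then v x else 0].

Definition wf_fact (a m : nat) (schema : 'I_m -> {set 'I_a}) (f : fact a m) : Prop :=
  forall x, x \notin schema f.1 -> f.2 x = 0.

Definition attrQ (a m : nat) (schema : 'I_m -> {set 'I_a}) : {set 'I_a} :=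
  \bigcup_(i < m) schema i.

Definition share (a m : nat) (schema : 'I_m -> {set 'I_a}) : rel 'I_m :=
  fun i j => ~~ [disjoint schema i & schema j].

Definition connectedQ (a m : nat) (schema : 'I_m -> {set 'I_a}) : Prop :=
  forall i j : 'I_m, connect (share schema) i j.

Definition answer (a m : nat) (schema : 'I_m -> {set 'I_a}) (head : {set 'I_a})
    (D : seq (fact a m)) (t : {ffun 'I_a -> nat}) : Prop :=
  (forall x, x \notin head -> t x = 0) /\
  exists v : 'I_a -> nat,
    (forall x, x \in head -> v x = t x) /\
    (forall i : 'I_m, (i, restrict (schema i) v) \in D).

Definition same_answers (a m : nat) (schema : 'I_m -> {set 'I_a}) (head : {set 'I_a})
    (D1 D2 : seq (fact a m)) : Prop :=
  forall t, answer schema head D1 t <-> answer schema head D2 t.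

Inductive instr :=
| IConst of nat & nat
| IAdd of nat & nat & nat
| ISub of nat & nat & nat
| ILoad of nat & nat
| IStore of nat & nat
| IJz of nat & nat
| IHalt.

Record config := Config { pc : nat; reg : nat -> nat; mem : nat -> nat }.

Definition upd (f : nat -> nat) (k v : nat) : nat -> nat :=
  fun y => if y == k then v else f y.

Definition step (P : seq instr) (c : config) : option config :=
  let: Config p r M := c in
  if p < size P then
    match nth IHalt P p with
    | IConst r1 n => Some (Config p.+1 (upd r r1 n) M)
    | IAdd r1 r2 r3 => Some (Config p.+1 (upd r r1 (r r2 + r r3)) M)
    | ISub r1 r2 r3 => Some (Config p.+1 (upd r r1 (r r2 - r r3)) M)
    | ILoad r1 r2 => Some (Config p.+1 (upd r r1 (M (r r2))) M)
    | IStore r1 r2 => Some (Config p.+1 r (upd M (r r1) (r r2)))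
    | IJz r1 l => Some (Config (if r r1 == 0 then l else p.+1) r M)
    | IHalt => None
    end
  else None.

Definition halted (P : seq instr) (c : config) : bool :=
  if step P c is None then true else false.

Fixpoint run (P : seq instr) (t : nat) (c : config) : config :=
  match t with
  | 0 => c
  | t'.+1 => if step P c is Some c' then run P t' c' else c
  end.

(* Input encoding of a database given as a list s of facts:           *)
(* mem 0 = |s|; fact j occupies cells 1 + j(a+1) .. (j+1)(a+1):       *)
(* first the relation index, then the a attribute values.            *)
Definition encode_fact (a m : nat) (f : fact a m) : seq nat :=
  nat_of_ord f.1 :: [seq f.2 x | x <- enum 'I_a].

Definition encode (a m : nat) (s : seq (fact a m)) : nat -> nat :=
  fun y => nth 0 (size s :: flatten [seq encode_fact f | f <- s]) y.

Definition init_config (a m : nat) (s : seq (fact a m)) : config :=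
  Config 0 (fun _ => 0) (encode s).

(* Output convention: at halting, mem 0 = k and mem 1, ..., mem k are  *)
(* indices (< |s|) of the selected facts of the input list s.          *)
Definition out_indices (c : config) : seq nat :=
  [seq mem c i.+1 | i <- iota 0 (mem c 0)].

Definition output_db (a m : nat) (s : seq (fact a m)) (c : config) : seq (fact a m) :=
  pmap (fun j => nth None (map Some s) j) (out_indices c).

(* Main.v *)
Require Import Defs.
From mathcomp Require Import all_boot zify.

Set Implicit Arguments. Unset Strict Implicit. Unset Printing Implicit Defensive.

(** Let B be the only non-head attribute.  The facts that do not mention B are
    forced: every solution keeps those that take part in some answer.  For the
    others, fix a value b of B; the answers having a witness with B = b are the
    hyperedges of a hypergraph on the facts with B = b, each of rank at most m.
    For l = L, L-1, ..., 1 and every b, peel off the facts lying in fewer than l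
    uncovered hyperedges and keep the remaining core.  By double counting, the
    core has at most m/l facts per newly covered answer; by peeling, no set S of
    facts spans more than (l-1)|S| uncovered hyperedges afterwards, so that at
    most (l-1) OPT answers remain uncovered after round l.  Hence the rounds
    l <= l' < 2l keep at most 2m OPT facts, and there are O(log N) such dyadic
    blocks. *)

(** * Covering answers by dense cores *)

(** Ordinary greedy set cover does not fit: an answer is covered only when all facts of one witness
    are kept, so a single fact may bring no progress. The unit that is bought is therefore a dense
    core, and peeling finds it without any optimisation. Having a single non-head attribute B is
    used in two ways. Two witnesses with the same answer and the same value of B coincide, so the
    hyperedges for one b stand for distinct answers. A fact that mentions B fixes b, so the
    hypergraphs for different b share no facts and the optimum splits along them. There are at most
    N ^ m witnesses, whose logarithm is m log N; this is where the second factor m of the ratio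
    comes from. The running time of the algorithm is never analysed as such. The algorithm is
    written in a small language in which all loops share one bound, here N ^ m, so that every
    program is polynomial by induction on its syntax. The price is that witnesses, facts, values of
    B and thresholds are all enumerated by indices below N ^ m, and that products and quotients,
    which the machine does not have, are obtained by counting. *)

Lemma iter_shrink_fix (J : finType) (f : {set J} -> {set J}) n (A : {set J}) :
  (forall A, f A \subset A) -> #|A| <= n -> f (iter n f A) = iter n f A.
Proof.
move=> fS; elim: n A => [|n IHn] A leAn.
  apply/eqP; rewrite eqEcard fS /=; exact: leq_trans leAn (leq0n _).
(* Unless [A] is already a fixpoint, one application loses an element. *)
rewrite iterSr; have [fA|nfA] := eqVneq (f A) A.
  by rewrite !fA !iter_fix // fA.
apply: IHn; rewrite -ltnS; apply: leq_trans leAn; apply: proper_card.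
by rewrite properEneq nfA fS.
Qed.

Section Greedy.
(** [X] stands for the witnesses, [J] for the facts, [same] for having the same answer, [bv] for the
    value of B, and [FB] for the facts of a witness that mention B. *)
Variables (X J : finType) (valid : pred X) (same : rel X) (bv : X -> nat).
Variables (FB : X -> {set J}) (p : nat).
Hypothesis same_equiv : equivalence_rel same.
Hypothesis card_FB : forall x, #|FB x| <= p.
Hypothesis bv_inj : forall x y, valid x -> valid y -> same x y -> bv x = bv y -> x = y.
Hypothesis FB_bv : forall x y j,
  valid x -> valid y -> j \in FB x -> j \in FB y -> bv x = bv y.

Implicit Types (K A S : {set J}) (b l : nat).

(** One witness with its B-facts in [K] suffices for an answer; the facts without B are kept
    separately, as [forced]. *)
Definition cov K x := [exists y, [&& valid y, same x y & FB y \subset K]].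

Definition edge K A b :=
  [set x | [&& valid x, bv x == b, ~~ cov K x & FB x \subset A]].

Definition deg K A b j := #|[set x in edge K A b | j \in FB x]|.

Definition peel K b l A j := if deg K A b j < l then A :\ j else A.

(** Repeated full sweeps replace the search for a fact to peel; from [#|J|] sweeps on, the result is
    a fixpoint. *)
Definition core n K b l := iter n (fun A => foldl (peel K b l) A (enum J)) setT.

Definition level n bs K l := foldl (fun K b => K :|: core n K b l) K bs.

(** An uncovered answer is represented by the class of its valid witnesses, so that the cardinal
    counts answers and not witnesses. *)
Definition ucls K := [set [set y | valid y && same x y] | x in X & valid x && ~~ cov K x].

Let same_refl x : same x x.
Proof. by case: (same_equiv x x x). Qed.

Let same_sym x y : same x y = same y x.
Proof.
apply/idP/idP => h.
  by have [_ /(_ h) <-] := same_equiv x y x; rewrite same_refl.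
by have [_ /(_ h) <-] := same_equiv y x y; rewrite same_refl.
Qed.

Let same_l x y z : same x y -> same x z = same y z.
Proof. by case: (same_equiv x y z). Qed.

Lemma cov_mono K K' x : K \subset K' -> cov K x -> cov K' x.
Proof.
move=> sKK /existsP[y /and3P[vy sy FK]]; apply/existsP; exists y.
by rewrite vy sy (subset_trans FK).
Qed.

Lemma cov_same K x y : same x y -> cov K x = cov K y.
Proof. by move=> sxy; apply: eq_existsb => z; rewrite (same_l z sxy). Qed.

Lemma foldl_peel_sub K b l A s : foldl (peel K b l) A s \subset A.
Proof.
elim: s A => //= j s IH A; apply: subset_trans (IH _) _.
by rewrite /peel; case: ifP => // _; rewrite subD1set.
Qed.

(** A fact is peeled only when its degree is below [l], so each peeled fact of [S] destroys at most
    [l.-1] of the edges inside [S]. *)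
Lemma peel_edges K b l S A j : 0 < l ->
  #|edge K S b| <= l.-1 * #|S :\: A| + #|edge K (S :&: A) b| ->
  #|edge K S b| <= l.-1 * #|S :\: peel K b l A j|
                   + #|edge K (S :&: peel K b l A j) b|.
Proof.
move=> l0 h; rewrite /peel; case: ifP => // dj; apply: leq_trans h _.
have [jS|jS] := boolP (j \in S :&: A); last first.
  have -> : S :&: (A :\ j) = S :&: A.
    apply/setP => i; rewrite !inE; case: eqP => // ->.
    by move: jS; rewrite !inE => /negbTE ->; rewrite andbF.
  rewrite leq_add2r leq_mul2l; apply/orP; right; apply: subset_leq_card.
  by apply: setDS; rewrite subD1set.
have -> : S :\: (A :\ j) = j |: (S :\: A).
  move: jS; rewrite inE => /andP[jS jA]; apply/setP => i; rewrite !inE.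
  by case: eqP => [->|] //=; rewrite jS.
rewrite cardsU1 !inE; move: jS; rewrite inE => /andP[jS jA]; rewrite jA /=.
have sub : edge K (S :&: A) b \subset
  [set x in edge K A b | j \in FB x] :|: edge K (S :&: A :\ j) b.
  apply/subsetP => x; rewrite !inE => /and4P[-> -> -> /= FS].
  rewrite !subsetD1 FS /=; move: FS; rewrite subsetI => /andP[_ ->] /=.
  by case: (_ \in _).
have := leq_trans (subset_leq_card sub) (leq_card_setU _ _).
by rewrite setIDA mulnDr muln1; move: dj; rewrite /deg; lia.
Qed.

Lemma core_edges n K b l S : 0 < l ->
  #|edge K S b| <= l.-1 * #|S| + #|edge K (S :&: core n K b l) b|.
Proof.
move=> l0.
have: #|edge K S b| <= l.-1 * #|S :\: core n K b l| + #|edge K (S :&: core n K b l) b|.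
  rewrite /core; elim: n => [|n IH] /=; first by rewrite setIT leq_addl.
  elim: (enum J) (iter _ _ _) IH => //= j s IH A hA.
  by apply: IH; apply: peel_edges.
move/leq_trans; apply; rewrite leq_add2r leq_mul2l subset_leq_card ?orbT //.
exact: subsetDl.
Qed.

Lemma core_deg n K b l j : #|J| <= n -> j \in core n K b l ->
  l <= deg K (core n K b l) b j.
Proof.
move=> Jn; rewrite /core.
set f := fun A => foldl _ A _.
have fS A : f A \subset A by apply: foldl_peel_sub.
have := @iter_shrink_fix J f n setT fS; rewrite cardsT => /(_ Jn).
move: (iter _ _ _) => A; rewrite /f => fA jA.
have: j \in enum J by rewrite mem_enum.
elim: (enum J) fA => //= i s IH fA.
(* Peels only shrink, so a sweep that returns [A] contains no peel that changes it. *)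
have pA : peel K b l A i = A.
  apply/eqP; rewrite eqEsubset; apply/andP; split.
    exact: (foldl_peel_sub K b l A [:: i]).
  by rewrite -{1}fA foldl_peel_sub.
rewrite pA in fA; rewrite inE => /orP[/eqP ji|]; last exact: IH.
move: pA; rewrite /peel -ji; case: ltnP => // _ /setP/(_ j).
by rewrite !inE eqxx jA.
Qed.

Lemma core_handshake n K b l : #|J| <= n ->
  l * #|core n K b l| <= p * #|edge K (core n K b l) b|.
Proof.
move=> Jn; set C := core _ _ _ _.
have h : l * #|C| <= \sum_(j in C) deg K C b j.
  by rewrite mulnC -sum_nat_const; apply: leq_sum => j; apply: core_deg.
apply: leq_trans h _.
have -> : \sum_(j in C) deg K C b j =
  \sum_(j in C) \sum_(x in edge K C b) (j \in FB x).
  apply: eq_bigr => j _; rewrite /deg -sum1_card -big_mkcondr /=.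
  by apply: eq_bigl => x; rewrite [in LHS]inE.
rewrite exchange_big /= mulnC -sum_nat_const; apply: leq_sum => x _.
apply: leq_trans (card_FB x); rewrite -sum1_card big_mkcond [leqRHS]big_mkcond /=.
by apply: leq_sum => j _; case: (_ \in C); case: (_ \in FB x).
Qed.

(** [l * #|K| + p * #|ucls K|] acts as a potential: [l] times the core is at most [p] times the
    number of its edges, and by [bv_inj] these edges belong to distinct answers, all newly
    covered. *)
Lemma core_progress n K b l : #|J| <= n ->
  l * #|K :|: core n K b l| + p * #|ucls (K :|: core n K b l)|
  <= l * #|K| + p * #|ucls K|.
Proof.
move=> Jn; have := core_handshake K b l Jn; set C := core _ _ _ _ => hC.
set cl := fun x => [set y | valid y && same x y].
have icl : {in edge K C b &, injective cl}.
  move=> x y; rewrite !inE => /and4P[vx /eqP bx _ _] /and4P[vy /eqP by_ _ _].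
  move=> /setP/(_ y); rewrite !inE vy same_refl /= => sxy.
  by apply: bv_inj; rewrite // bx by_.
have sub : cl @: edge K C b :|: ucls (K :|: C) \subset ucls K.
  rewrite subUset; apply/andP; split.
    apply/subsetP => _ /imsetP[x + ->]; rewrite inE => /and4P[vx _ nc _].
    by apply: imset_f; rewrite !inE vx nc.
  apply/subsetP => _ /imsetP[x + ->]; rewrite inE => /andP[_ /andP[vx nc]].
  apply: imset_f; rewrite !inE vx /=; apply: contra nc; apply: cov_mono.
  exact: subsetUl.
have dis : [disjoint cl @: edge K C b & ucls (K :|: C)].
  apply/pred0P => z /=; apply/negP => /andP[/imsetP[x xe ->]] /imsetP[y].
  rewrite inE => /andP[_ /andP[vy nc]] /setP/(_ y); rewrite !inE vy same_refl /= => sxy.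
  move: xe; rewrite inE => /and4P[vx _ _ FC]; case/negP: nc.
  apply/existsP; exists x; rewrite vx same_sym sxy /=.
  by rewrite (subset_trans FC) ?subsetUr.
have := subset_leq_card sub; rewrite cardsU disjoint_setI0 // cards0 subn0.
rewrite card_in_imset // => h.
have : p * (#|edge K C b| + #|ucls (K :|: C)|) <= p * #|ucls K| by rewrite leq_mul2l h orbT.
have : l * #|K :|: C| <= l * (#|K| + #|C|) by rewrite leq_mul2l leq_card_setU orbT.
by rewrite !mulnDr; lia.
Qed.

(** The core covers its own edges, so an edge of [S] that is still uncovered does not lie inside it;
    this cancels the last term of [core_edges]. *)
Lemma core_after n K b l S : 0 < l ->
  #|edge (K :|: core n K b l) S b| <= l.-1 * #|S|.
Proof.
move=> l0; have := core_edges n K b S l0; set C := core _ _ _ _ => h.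
rewrite -(leq_add2r #|edge K (S :&: C) b|); apply: leq_trans h.
rewrite -cardsUI; have -> : edge (K :|: C) S b :&: edge K (S :&: C) b = set0.
  apply/setP => x; rewrite !inE; apply/negP.
  move=> /andP[/and4P[vx _ nc _] /and4P[_ _ _ FC]]; case/negP: nc.
  apply/existsP; exists x; rewrite vx same_refl /= (subset_trans FC) //.
  by rewrite (subset_trans (subsetIr _ _)) ?subsetUr.
rewrite cards0 addn0 subset_leq_card // subUset; apply/andP; split; apply/subsetP => x.
  rewrite !inE => /and4P[-> -> nc ->] /=; rewrite andbT; apply: contra nc.
  by apply: cov_mono; exact: subsetUl.
by rewrite !inE => /and4P[-> -> -> FC]; rewrite (subset_trans FC) ?subsetIl.
Qed.

Lemma edge_mono K K' S b : K \subset K' -> #|edge K' S b| <= #|edge K S b|.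
Proof.
move=> sKK; apply: subset_leq_card; apply/subsetP => x.
rewrite !inE => /and4P[-> -> nc ->] /=; rewrite andbT.
by apply: contra nc; apply: cov_mono.
Qed.

Lemma level_sub n bs K l : K \subset level n bs K l.
Proof.
rewrite /level; elim: bs K => //= b bs IH K.
by apply: subset_trans (IH _); exact: subsetUl.
Qed.

Lemma level_progress n bs K l : #|J| <= n ->
  l * #|level n bs K l| + p * #|ucls (level n bs K l)| <= l * #|K| + p * #|ucls K|.
Proof.
move=> Jn; rewrite /level; elim: bs K => //= b bs IH K.
by apply: leq_trans (IH _) _; apply: core_progress.
Qed.

(** The bound obtained when [b] is treated survives the later values, because enlarging [K] never
    creates an uncovered edge. *)
Lemma level_after n bs K l S b : 0 < l -> b \in bs ->
  #|edge (level n bs K l) S b| <= l.-1 * #|S|.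
Proof.
move=> l0; rewrite /level; elim: bs K => //= c bs IH K.
rewrite inE => /orP[/eqP <-|]; last exact: IH.
by apply: leq_trans (core_after n K b S l0); apply: edge_mono; apply: level_sub.
Qed.

(** * Comparison with an arbitrary cover *)

Section Opt.
Variable S : {set J}.
Hypothesis Scov : forall x, valid x -> cov S x.

(** Every uncovered answer has an edge inside [S]. For each b, [level_after] is applied only to the
    facts of [S] on edges with that b; by [FB_bv] these parts of [S] are disjoint, so their sizes
    add up to at most [#|S|]. *)
Lemma level_opt n bs K l : 0 < l -> (forall x, valid x -> bv x \in bs) ->
  #|ucls (level n bs K l)| <= l.-1 * #|S|.
Proof.
move=> l0 bsP; set K' := level _ _ _ _.
have l1 b : b \in undup bs -> #|edge K' S b| <= l.-1 * #|S :&: \bigcup_(x in edge K' S b) FB x|.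
  rewrite mem_undup => bb.
  have := @level_after n bs K l (S :&: \bigcup_(x in edge K' S b) FB x) b l0 bb.
  apply: leq_trans; apply: subset_leq_card; apply/subsetP => x xe.
  have := xe; rewrite !inE => /and4P[-> -> -> FS] /=.
  by rewrite subsetI FS; apply: (bigcup_sup x).
have l2 : #|ucls K'| <= \sum_(b <- undup bs) #|edge K' S b|.
  set cl := fun x => [set y | valid y && same x y].
  have: #|cl @: (\bigcup_(b <- undup bs) edge K' S b)| <= \sum_(b <- undup bs) #|edge K' S b|.
    apply: leq_trans (leq_imset_card _ _) _.
    elim: (undup bs) => [|b r IH]; first by rewrite !big_nil cards0.
    by rewrite !big_cons; apply: leq_trans (leq_card_setU _ _) _; rewrite leq_add2l.
  apply: leq_trans; apply: subset_leq_card; apply/subsetP => _ /imsetP[x + ->].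
  rewrite inE => /andP[_ /andP[vx nc]].
  have /existsP[y /and3P[vy sxy FS]] := Scov vx.
  have -> : [set y | valid y && same x y] = cl y.
    by apply/setP => z; rewrite !inE (same_l z sxy).
  apply: imset_f; have ye : y \in edge K' S (bv y).
    by rewrite inE vy eqxx FS -(cov_same _ sxy) nc.
  have: bv y \in undup bs by rewrite mem_undup bsP.
  elim: (undup bs) => //= b r IH; rewrite inE big_cons in_setU.
  by case/orP => [/eqP <-|/IH ->]; rewrite ?ye ?orbT.
apply: leq_trans l2 _.
apply: leq_trans (_ : \sum_(b <- undup bs) l.-1 * #|S :&: \bigcup_(x in edge K' S b) FB x| <= _).
  by rewrite big_seq [leqRHS]big_seq; apply: leq_sum.
rewrite -big_distrr leq_mul2l /=; apply/orP; right.
suff h : forall r, uniq r -> \sum_(b <- r) #|S :&: \bigcup_(x in edge K' S b) FB x|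
    <= #|S :&: \bigcup_(x | valid x && (bv x \in r)) FB x|.
  apply: leq_trans (h _ (undup_uniq _)) _.
  by apply: subset_leq_card; apply: subsetIl.
elim=> [|b r IH] /=; first by rewrite big_nil.
move=> /andP[br ur]; rewrite big_cons; apply: leq_trans (leq_add (leqnn _) (IH ur)) _.
rewrite -cardsUI.
have -> : (S :&: \bigcup_(x in edge K' S b) FB x)
   :&: (S :&: \bigcup_(x | valid x && (bv x \in r)) FB x) = set0.
  apply/setP => j; rewrite !inE; apply/negP.
  move=> /andP[/andP[_ /bigcupP[x + jx]] /andP[_ /bigcupP[y /andP[vy byr] jy]]].
  rewrite inE => /and4P[vx /eqP bx _ _].
  by move: br; rewrite -bx (FB_bv vx vy jx jy) byr.
rewrite cards0 addn0; apply: subset_leq_card; rewrite -setIUr; apply: setIS.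
rewrite subUset; apply/andP; split; apply/bigcupsP => x.
  by rewrite inE => /and4P[vx /eqP <- _ _]; apply: bigcup_sup; rewrite vx mem_head.
by move=> /andP[vx bx]; apply: bigcup_sup; rewrite vx inE bx orbT.
Qed.

End Opt.

(** * Summation over the thresholds *)

Section Bound.
Variables (n : nat) (bs : seq nat) (L : nat).
Hypotheses (Jn : #|J| <= n) (bsP : forall x, valid x -> bv x \in bs) (XL : #|X| <= L).

(** The threshold falls by one per round, which a plain counting loop can do; the dyadic blocks
    occur only in the analysis. *)
Definition greedy t := foldl (fun K r => level n bs K (L - r)) set0 (iota 0 t).

Lemma greedyS t : greedy t.+1 = level n bs (greedy t) (L - t).
Proof. by rewrite /greedy -addn1 iotaD foldl_cat. Qed.

(* The facts kept after the rounds with threshold at least [l]; none if [L < l]. *)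
Let H l := greedy (L.+1 - l).

Let H_big l : L < l -> H l = set0.
Proof. by move=> ltl; rewrite /H; have -> : L.+1 - l = 0 by lia. Qed.

Let H_rec l : 0 < l <= L -> H l = level n bs (H l.+1) l.
Proof.
move=> lL; rewrite /H; have -> : L.+1 - l = (L.+1 - l.+1).+1 by lia.
by rewrite greedyS; congr level; lia.
Qed.

Let H_sub l : 0 < l -> #|H l.+1| <= #|H l|.
Proof.
move=> l0; have [ltl|lel] := ltnP L l; first by rewrite !H_big ?cards0 // ltnW.
by rewrite (@H_rec l) ?l0 // subset_leq_card // level_sub.
Qed.

Let H_prog l : 0 < l ->
  l * #|H l| + p * #|ucls (H l)| <= l * #|H l.+1| + p * #|ucls (H l.+1)|.
Proof.
move=> l0; have [ltl|lel] := ltnP L l; first by rewrite !H_big // ltnW.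
by rewrite (@H_rec l) ?l0 //; apply: level_progress.
Qed.

(** A round with threshold above [l] pays for each new fact with more newly covered answers than
    weight [l] asks for, so the potential with the fixed weight [l] does not increase either. *)
Let H_block l t : 0 < l ->
  l * #|H l| + p * #|ucls (H l)| <= l * #|H (l + t)| + p * #|ucls (H (l + t))|.
Proof.
move=> l0; elim: t => [|t IH]; first by rewrite addn0.
apply: leq_trans IH _; rewrite addnS.
have lt0 : 0 < l + t by rewrite addn_gt0 l0.
have := H_prog lt0; have := H_sub lt0.
move: #|H _| #|H _| (p * _) (p * _) => a b c d; nia.
Qed.

Let H_opt S l : (forall x, valid x -> cov S x) -> 0 < l -> #|ucls (H l)| <= l.-1 * #|S|.
Proof.
move=> Scov l0; have [ltl|lel] := ltnP L l; last by rewrite H_rec ?l0 //; apply: level_opt.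
(* Before the first round the bound comes from [#|X| <= L <= l.-1], which requires [S] to be
   nonempty; an empty cover means that nothing is uncovered. *)
have [S0|Sn] := posnP #|S|.
  suff -> : ucls (H l) = set0 by rewrite cards0.
  apply/setP => z; rewrite !inE; apply/negP => /imsetP[x + _].
  rewrite inE => /andP[_ /andP[vx]]; apply/negP; rewrite negbK.
  by apply: cov_mono (Scov x vx); rewrite (cards0_eq S0) sub0set.
apply: leq_trans (leq_imset_card _ _) _; apply: leq_trans (max_card _) _.
by apply: leq_trans XL _; apply: leq_trans (leq_pmulr _ Sn); lia.
Qed.

(** At threshold 1 the bound of [H_opt] is zero for every cover, in particular for the set of all
    facts. *)
Lemma greedy_cov x : valid x -> cov (greedy L) x.
Proof.
move=> vx; have L0 : 0 < L by apply: leq_trans XL; apply/card_gt0P; exists x.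
have TC : forall y, valid y -> cov setT y.
  by move=> y vy; apply/existsP; exists y; rewrite vy same_refl subsetT.
have := @H_opt setT 1 TC isT; rewrite mul0n leqn0 cards_eq0 /H subSS subn0.
apply: contraLR => nc; apply/set0Pn; exists [set y | valid y && same x y].
by apply/imsetP; exists x => //; rewrite !inE vx nc.
Qed.

Lemma greedy_card S k : (forall x, valid x -> cov S x) -> L < 2 ^ k ->
  #|greedy L| <= 2 * p * k * #|S|.
Proof.
move=> Scov Lk.
suff: #|H 1| <= #|H (2 ^ k)| + 2 * p * k * #|S|.
  by rewrite (H_big Lk) cards0 add0n /H subSS subn0.
elim: k {Lk} => [|k IH]; first by rewrite expn0 leq_addr.
apply: leq_trans IH _; set l := 2 ^ k; have l0 : 0 < l by rewrite expn_gt0.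
have := H_block l l0; have ll0 : 0 < l + l by rewrite addn_gt0 l0.
have := H_opt Scov ll0; rewrite addnn -mul2n -expnS -/l => h1 h2.
have h3 : p * #|ucls (H (2 ^ k.+1))| <= l * (2 * p * #|S|).
  have : p * #|ucls (H (2 ^ k.+1))| <= p * ((2 ^ k.+1).-1 * #|S|) by rewrite leq_mul2l h1 orbT.
  move/leq_trans; apply; rewrite expnS -/l; have : (2 * l).-1 <= 2 * l by lia.
  by nia.
have : l * #|H l| <= l * (#|H (2 ^ k.+1)| + 2 * p * #|S|).
  by rewrite mulnDr; lia.
rewrite leq_pmul2l // => h4; nia.
Qed.
End Bound.

End Greedy.

(** * A language of bounded loops and its compilation *)

(** Binders are local and all loops share one bound, so termination and the step bound can be read
    off the syntax. *)
Inductive expr :=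
| EC of nat
| EV of nat
| EL
| EAdd of expr & expr
| ESub of expr & expr
| ELd of expr
| EIf of expr & expr & expr
| ELet of nat & expr & expr
| ESum of nat & expr.

Inductive stmt :=
| SSt of expr & expr
| SSeq of stmt & stmt
| SIf of expr & stmt
| SLet of nat & expr & stmt
| SFor of nat & stmt.

Fixpoint eval (n : nat) (env M : nat -> nat) (e : expr) : nat :=
  match e with
  | EC c => c
  | EV x => env x
  | EL => n
  | EAdd e1 e2 => eval n env M e1 + eval n env M e2
  | ESub e1 e2 => eval n env M e1 - eval n env M e2
  | ELd e1 => M (eval n env M e1)
  | EIf c e1 e2 => if eval n env M c == 0 then eval n env M e2 else eval n env M e1
  | ELet x e1 e2 => eval n (upd env x (eval n env M e1)) M e2
  | ESum x e1 => \sum_(i < n) eval n (upd env x i) M e1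
  end.

Fixpoint exec (n : nat) (env M : nat -> nat) (s : stmt) : nat -> nat :=
  match s with
  | SSt e1 e2 => upd M (eval n env M e1) (eval n env M e2)
  | SSeq s1 s2 => exec n env (exec n env M s1) s2
  | SIf c s1 => if eval n env M c == 0 then M else exec n env M s1
  | SLet x e s1 => exec n (upd env x (eval n env M e)) M s1
  | SFor x s1 => foldl (fun M' i => exec n (upd env x i) M' s1) M (iota 0 n)
  end.

(* Register 0 holds the common bound of all loops; variables live in the odd
   registers and temporaries in the positive even ones. *)
Definition vr x := x.*2.+1.
Definition tr d := d.*2.+2.

Lemma vr_eq x y : (vr x == vr y) = (x == y). Proof. by rewrite /vr; lia. Qed.
Lemma tr_eq d d' : (tr d == tr d') = (d == d'). Proof. by rewrite /tr; lia. Qed.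
Lemma vr_tr x d : (vr x == tr d) = false. Proof. by rewrite /vr /tr; lia. Qed.
Lemma tr_vr x d : (tr d == vr x) = false. Proof. by rewrite /vr /tr; lia. Qed.
Lemma z_vr x : (0 == vr x) = false. Proof. by []. Qed.
Lemma z_tr x : (0 == tr x) = false. Proof. by []. Qed.
Lemma nSn n : (n == n.+1) = false. Proof. by lia. Qed.
Lemma Snn n : (n.+1 == n) = false. Proof. by lia. Qed.
Lemma nSSn n : (n == n.+2) = false. Proof. by lia. Qed.
Lemma SSnn n : (n.+2 == n) = false. Proof. by lia. Qed.

Definition regE := (vr_eq, tr_eq, vr_tr, tr_vr, z_vr, z_tr, nSn, Snn, nSSn, SSnn, eqxx).

Opaque vr tr.

(* Leaves the value of [e] in temporary [d], clobbering only temporaries [>= d]. *)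
Fixpoint comp (e : expr) (d off : nat) : seq instr :=
  match e with
  | EC c => [:: IConst (tr d) c]
  | EV x => [:: IConst (tr d) 0; IAdd (tr d) (vr x) (tr d)]
  | EL => [:: IConst (tr d) 0; IAdd (tr d) 0 (tr d)]
  | EAdd e1 e2 =>
    let c1 := comp e1 d off in
    let c2 := comp e2 d.+1 (off + size c1) in
    c1 ++ c2 ++ [:: IAdd (tr d) (tr d) (tr d.+1)]
  | ESub e1 e2 =>
    let c1 := comp e1 d off in
    let c2 := comp e2 d.+1 (off + size c1) in
    c1 ++ c2 ++ [:: ISub (tr d) (tr d) (tr d.+1)]
  | ELd e1 => comp e1 d off ++ [:: ILoad (tr d) (tr d)]
  | EIf e0 e1 e2 =>
    let c0 := comp e0 d off in
    let o1 := (off + size c0).+1 in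
    let c1 := comp e1 d o1 in
    let o2 := (o1 + size c1).+2 in
    let c2 := comp e2 d o2 in
    c0 ++ IJz (tr d) o2 :: c1 ++
    IConst (tr d.+1) 0 :: IJz (tr d.+1) (o2 + size c2) :: c2
  | ELet x e1 e2 =>
    let c1 := comp e1 d.+1 off in
    let o2 := (off + size c1).+4 in
    let c2 := comp e2 d.+1 o2 in
    c1 ++ IConst (tr d) 0 :: IAdd (tr d) (vr x) (tr d) ::
      IConst (vr x) 0 :: IAdd (vr x) (tr d.+1) (vr x) ::
    c2 ++ [:: IConst (vr x) 0; IAdd (vr x) (tr d) (vr x);
              IConst (tr d) 0; IAdd (tr d) (tr d.+1) (tr d)]
  | ESum x e1 =>
    let c1 := comp e1 d.+2 off.+4.+1 in
    [:: IConst (tr d) 0; IAdd (tr d.+1) (vr x) (tr d); IConst (vr x) 0;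
        ISub (tr d.+2) 0 (vr x); IJz (tr d.+2) (off.+4.+1 + size c1).+4.+1] ++
    c1 ++
    [:: IAdd (tr d) (tr d) (tr d.+2); IConst (tr d.+2) 1;
        IAdd (vr x) (vr x) (tr d.+2); IConst (tr d.+2) 0;
        IJz (tr d.+2) off.+3;
        IAdd (vr x) (tr d.+1) (tr d.+2)]
  end.

Fixpoint comps (s : stmt) (d off : nat) : seq instr :=
  match s with
  | SSt e1 e2 =>
    let c1 := comp e1 d off in
    let c2 := comp e2 d.+1 (off + size c1) in
    c1 ++ c2 ++ [:: IStore (tr d) (tr d.+1)]
  | SSeq s1 s2 =>
    let c1 := comps s1 d off in
    c1 ++ comps s2 d (off + size c1)
  | SIf e s1 =>
    let c0 := comp e d off in
    let c1 := comps s1 d (off + size c0).+1 in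
    c0 ++ IJz (tr d) (off + size c0 + size c1).+1 :: c1
  | SLet x e s1 =>
    let c1 := comp e d.+1 off in
    let c2 := comps s1 d.+1 (off + size c1).+4 in
    c1 ++ IConst (tr d) 0 :: IAdd (tr d) (vr x) (tr d) ::
      IConst (vr x) 0 :: IAdd (vr x) (tr d.+1) (vr x) ::
    c2 ++ [:: IConst (vr x) 0; IAdd (vr x) (tr d) (vr x)]
  | SFor x s1 =>
    let c1 := comps s1 d.+1 off.+4.+1 in
    [:: IConst (tr d) 0; IAdd (tr d) (vr x) (tr d); IConst (vr x) 0;
        ISub (tr d.+1) 0 (vr x); IJz (tr d.+1) (off.+4.+1 + size c1).+4] ++
    c1 ++
    [:: IConst (tr d.+1) 1; IAdd (vr x) (vr x) (tr d.+1);
        IConst (tr d.+1) 0; IJz (tr d.+1) off.+3;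
        IAdd (vr x) (tr d) (tr d.+1)]
  end.

(** * Polynomial step bounds *)

Fixpoint ecost (e : expr) (n : nat) : nat :=
  match e with
  | EC _ => 1
  | EV _ | EL => 2
  | EAdd e1 e2 | ESub e1 e2 => ecost e1 n + ecost e2 n + 1
  | ELd e1 => ecost e1 n + 1
  | EIf e0 e1 e2 => ecost e0 n + ecost e1 n + ecost e2 n + 3
  | ELet _ e1 e2 => ecost e1 n + ecost e2 n + 8
  | ESum _ e1 => 6 + n * (ecost e1 n + 7)
  end.

Fixpoint scost (s : stmt) (n : nat) : nat :=
  match s with
  | SSt e1 e2 => ecost e1 n + ecost e2 n + 1
  | SSeq s1 s2 => scost s1 n + scost s2 n
  | SIf e s1 => ecost e n + scost s1 n + 1
  | SLet _ e s1 => ecost e n + scost s1 n + 6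
  | SFor _ s1 => 6 + n * (scost s1 n + 6)
  end.

Definition polyb (f : nat -> nat) := exists c k, forall n, f n <= c * n.+1 ^ k.

Lemma polyb_const c : polyb (fun _ => c).
Proof. by exists c, 0 => n; rewrite expn0 muln1. Qed.

Lemma polyb_id : polyb id.
Proof. by exists 1, 1 => n; rewrite expn1 mul1n. Qed.

Lemma polybD f g : polyb f -> polyb g -> polyb (fun n => f n + g n).
Proof.
move=> [c [k fP]] [c' [k' gP]]; exists (c + c'), (k + k') => n.
rewrite mulnDl; apply: leq_add.
  by apply: leq_trans (fP n) _; rewrite leq_mul2l leq_pexp2l ?orbT ?leq_addr.
by apply: leq_trans (gP n) _; rewrite leq_mul2l leq_pexp2l ?orbT ?leq_addl.
Qed.

Lemma polybM f g : polyb f -> polyb g -> polyb (fun n => f n * g n).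
Proof.
move=> [c [k fP]] [c' [k' gP]]; exists (c * c'), (k + k') => n.
by rewrite expnD mulnACA leq_mul.
Qed.

Lemma polyb_ecost e : polyb (ecost e).
Proof.
elim: e => /= *; rewrite -/ecost; do ?[apply: polybD | apply: polybM | apply: polyb_const |
  apply: polyb_id | assumption].
Qed.

Lemma polyb_scost s : polyb (scost s).
Proof.
elim: s => /= *; do ?[apply: polybD | apply: polybM | apply: polyb_const |
  apply: polyb_id | apply: polyb_ecost | assumption].
Qed.

(** * Bounded runs and code fragments *)

Lemma run_halted P t c : step P c = None -> run P t c = c.
Proof. by case: t => //= t ->. Qed.

Lemma run_add P t1 t2 c : run P (t1 + t2) c = run P t2 (run P t1 c).
Proof.
elim: t1 c => //= t1 IH c; case E: step => [c'|]; first exact: IH.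
by rewrite run_halted.
Qed.

(** Only an upper bound on the number of steps is recorded, so that branches of different lengths
    fit one cost. *)
Definition reach P n c c' := exists2 t, t <= n & run P t c = c'.

Lemma reach_trans P n1 n2 c1 c2 c3 :
  reach P n1 c1 c2 -> reach P n2 c2 c3 -> reach P (n1 + n2) c1 c3.
Proof.
move=> [t1 l1 r1] [t2 l2 r2]; exists (t1 + t2); first exact: leq_add.
by rewrite run_add r1 r2.
Qed.

Lemma reach_le P n1 n2 c c' : n1 <= n2 -> reach P n1 c c' -> reach P n2 c c'.
Proof. by move=> l [t lt rt]; exists t => //; apply: leq_trans l. Qed.

Lemma reach_step P n c c1 c2 : step P c = Some c1 -> reach P n c1 c2 -> reach P n.+1 c c2.
Proof. by move=> s1 [t lt rt]; exists t.+1; rewrite //= s1. Qed.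

Lemma reach0 P n c : reach P n c c.
Proof. by exists 0. Qed.

Fixpoint code_at (P : seq instr) (off : nat) (c : seq instr) : Prop :=
  if c is i :: c' then onth P off = Some i /\ code_at P off.+1 c' else True.

Lemma code_at_cat P off c1 c2 :
  code_at P off (c1 ++ c2) <-> code_at P off c1 /\ code_at P (off + size c1) c2.
Proof.
elim: c1 off => [|i c1 IH] off /=; first by rewrite addn0; tauto.
by rewrite IH addSnnS; tauto.
Qed.

Lemma code_at_self P1 P2 P3 : code_at (P1 ++ P2 ++ P3) (size P1) P2.
Proof.
elim: P2 P1 => //= i P2 IH P1; split.
  elim: P1 => //=.
by have := IH (rcons P1 i); rewrite size_rcons cat_rcons.
Qed.

(** The instruction part of [step], isolated so that a step at a known instruction holds by
    computation. *)
Definition after i p r M :=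
    match i with
    | IConst r1 n => Some (Config p.+1 (upd r r1 n) M)
    | IAdd r1 r2 r3 => Some (Config p.+1 (upd r r1 (r r2 + r r3)) M)
    | ISub r1 r2 r3 => Some (Config p.+1 (upd r r1 (r r2 - r r3)) M)
    | ILoad r1 r2 => Some (Config p.+1 (upd r r1 (M (r r2))) M)
    | IStore r1 r2 => Some (Config p.+1 r (upd M (r r1) (r r2)))
    | IJz r1 l => Some (Config (if r r1 == 0 then l else p.+1) r M)
    | IHalt => None
    end.

Lemma step_at P p r M i : onth P p = Some i -> step P (Config p r M) = after i p r M.
Proof.
move=> h; have lt : p < size P by rewrite -onthTE h.
by rewrite /step lt (@onth_nth _ IHalt _ _ _ h).
Qed.

(** * Correctness of the compilation *)

Definition rep n env r := r 0 = n /\ forall x, r (vr x) = env x :> nat.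

Lemma updE f k v x : upd f k v x = if x == k then v else f x.
Proof. by []. Qed.

(** The environment represented is the same before and after: a bound variable is parked in a
    temporary and restored. The last clause protects the temporaries of the enclosing expression. *)
Definition comp_spec e := forall P d off n env r M,
  code_at P off (comp e d off) -> rep n env r ->
  exists r', [/\ reach P (ecost e n) (Config off r M) (Config (off + size (comp e d off)) r' M),
    rep n env r', r' (tr d) = eval n env M e
    & forall d', d' < d -> r' (tr d') = r (tr d')].

Lemma reach_at P n p r M i c1 c2 : onth P p = Some i ->
  after i p r M = Some c1 -> reach P n c1 c2 -> reach P n.+1 (Config p r M) c2.
Proof. by move=> h a; apply: reach_step; rewrite (step_at _ _ h). Qed.

Ltac rst := eapply reach_at; [eassumption | reflexivity | ].
Lemma reach_eq P p p' r M : p = p' -> reach P 0 (Config p r M) (Config p' r M).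
Proof. by move=> ->; exact: reach0. Qed.

Ltac fr ltd := rewrite !updE !regE
  ?(ltn_eqF ltd) ?(ltn_eqF (leqW ltd)) ?(ltn_eqF (leqW (leqW ltd))).
Ltac rlast := apply: reach_eq; rewrite ?size_cat /= ?size_cat /= ?size_cat /=; lia.
Ltac rstart := eapply reach_le; last first.
Ltac rt lem := eapply reach_trans; [exact lem | ].
Ltac dst := repeat match goal with
  | H : _ /\ _ |- _ => destruct H
  | H : code_at _ _ (_ ++ _) |- _ => apply code_at_cat in H
  | H : code_at _ _ (_ :: _) |- _ => destruct H
  end.

Lemma comp_ok e : comp_spec e.
Proof.
elim: e.
- move=> c P d off n env r M /= [h _] [r0 rv].
  eexists; split.
  + rst. rewrite addn1. exact: reach0.
  + by split=> [|x]; rewrite !updE !regE.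
  + by rewrite updE !regE.
  + by move=> d' ltd; fr ltd.
- move=> c P d off n env r M /= [h [h' _]] [r0 rv].
  eexists; split.
  + rst. rst. rewrite addn2. exact: reach0.
  + by split=> [|x]; rewrite !updE !regE.
  + by rewrite !updE !regE addn0.
  + by move=> d' ltd; fr ltd.
- move=> P d off n env r M /= [h [h' _]] [r0 rv].
  eexists; split.
  + rst. rst. rewrite addn2. exact: reach0.
  + by split=> [|x]; rewrite !updE !regE.
  + by rewrite !updE !regE addn0.
  + by move=> d' ltd; fr ltd.
- move=> e1 IH1 e2 IH2 P d off n env r M /= c rr; dst.
  have [r1 [R1 rr1 v1 k1]] := IH1 _ _ _ _ _ _ M H rr.
  have [r2 [R2 rr2 v2 k2]] := IH2 _ _ _ _ _ _ M H0 rr1.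
  eexists; split.
  + rstart; first by rt R1; rt R2; rst; rlast.
    lia.
  + split=> [|x]; rewrite !updE !regE; by apply rr2.
  + by rewrite !updE !regE k2 // v1 v2.
  + by move=> d' ltd; fr ltd; rewrite k2 ?k1 ?leqW.
- move=> e1 IH1 e2 IH2 P d off n env r M /= c rr; dst.
  have [r1 [R1 rr1 v1 k1]] := IH1 _ _ _ _ _ _ M H rr.
  have [r2 [R2 rr2 v2 k2]] := IH2 _ _ _ _ _ _ M H0 rr1.
  eexists; split.
  + rstart; first by rt R1; rt R2; rst; rlast.
    lia.
  + split=> [|x]; rewrite !updE !regE; by apply rr2.
  + by rewrite !updE !regE k2 // v1 v2.
  + by move=> d' ltd; fr ltd; rewrite k2 ?k1 ?leqW.
- move=> e1 IH1 P d off n env r M /= c rr; dst.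
  have [r1 [R1 rr1 v1 k1]] := IH1 _ _ _ _ _ _ M H rr.
  eexists; split.
  + rstart; first by rt R1; rst; rlast.
    lia.
  + split=> [|x]; rewrite !updE !regE; by apply rr1.
  + by rewrite !updE !regE v1.
  + by move=> d' ltd; fr ltd; rewrite k1.
- move=> e0 IH0 e1 IH1 e2 IH2 P d off n env r M /= c rr; dst.
  have [r0 [R0 rr0 v0 k0]] := IH0 _ _ _ _ _ _ M H rr.
  case E: (eval n env M e0 == 0).
    have [r2 [R2 rr2 v2 k2]] := IH2 P d _ n env r0 M ltac:(eassumption) rr0.
    exists r2; split=> //.
    + rstart; first by rt R0; rst; rewrite v0 E; rt R2; rlast.
      lia.
    + by move=> d' ltd; rewrite k2 // k0.
  have [r1 [R1 rr1 v1 k1]] := IH1 P d _ n env r0 M ltac:(eassumption) rr0.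
  eexists; split.
  + rstart; first by rt R0; rst; rewrite v0 E; rt R1; rst; rst; rewrite updE !regE; rlast.
    lia.
  + split=> [|x]; rewrite !updE !regE; by apply rr1.
  + by rewrite !updE !regE v1.
  + by move=> d' ltd; fr ltd; rewrite k1 ?k0 ?leqW.
- move=> x e1 IH1 e2 IH2 P d off n env r M /= c rr; dst.
  have [r1 [R1 rr1 v1 k1]] := IH1 P d.+1 _ n env r M ltac:(eassumption) rr.
  pose ra := upd r1 (tr d) 0.
  pose rb := upd ra (tr d) (ra (vr x) + ra (tr d)).
  pose rc := upd rb (vr x) 0.
  pose rd := upd rc (vr x) (rc (tr d.+1) + rc (vr x)).
  have rrd : rep n (upd env x (eval n env M e1)) rd.
    split=> [|y]; rewrite /rd /rc /rb /ra !updE !regE; first by apply rr1.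
    by case: (y == x); rewrite ?v1 ?addn0 //; apply rr1.
  have dd : rd (tr d) = env x.
    by rewrite /rd /rc /rb /ra !updE !regE addn0; apply rr1.
  have [r2 [R2 rr2 v2 k2]] := IH2 P d.+1 _ n _ rd M ltac:(eassumption) rrd.
  eexists; split.
  + rstart; first by rt R1; do 4!rst; rt R2; do 4!rst; rlast.
    lia.
  + split=> [|y]; rewrite !updE !regE; first by apply rr2.
    rewrite addn0 k2 // dd; case: eqP => [->//|/eqP/negbTE ne].
    by rewrite (proj2 rr2 y) updE ne.
  + by rewrite !updE !regE addn0 v2.
  + move=> d' ltd; fr ltd; rewrite k2 ?leqW // /rd /rc /rb /ra; fr ltd.
    by rewrite k1 ?leqW.
- move=> x e1 IH1 P d off n env r M.
  rewrite /=; set c1 := comp e1 _ _ => c rr; dst.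
  (* Induction on the number [k] of iterations left, starting at the loop test. The extra 2 pays for
     the final test, which leaves 0 in [tr d.+2], as the addition restoring [x] requires. *)
  have loop k i r1 : i + k = n -> rep n (upd env x i) r1 -> exists r',
    [/\ reach P (k * (ecost e1 n + 7) + 2) (Config off.+3 r1 M)
          (Config (off.+4.+1 + size c1).+4.+1 r' M),
      rep n (upd env x n) r',
      r' (tr d) = r1 (tr d) + \sum_(i <= j < n) eval n (upd env x j) M e1,
      r' (tr d.+1) = r1 (tr d.+1) /\ r' (tr d.+2) = 0
      & forall d', d' < d -> r' (tr d') = r1 (tr d')].
    elim: k i r1 => [|k IHk] i r1 ikn rr1.
      rewrite addn0 in ikn; subst i; eexists; split.
      - rst; rst; rewrite !updE !regE (proj1 rr1) (proj2 rr1) updE eqxx subnn eqxx; exact: reach0.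
      - by split=> [|y]; rewrite !updE !regE; [apply rr1 | rewrite (proj2 rr1)].
      - by rewrite !updE !regE big_geq ?addn0.
      - by rewrite !updE !regE.
      - by move=> d' ltd; fr ltd.
    pose ra := upd r1 (tr d.+2) (r1 0 - r1 (vr x)).
    have rra : rep n (upd env x i) ra.
      by split=> [|y]; rewrite /ra !updE !regE; [apply rr1 | rewrite (proj2 rr1) updE].
    have [r2 [R2 rr2 v2 k2]] := IH1 P d.+2 _ n _ ra M ltac:(eassumption) rra.
    pose rb := upd r2 (tr d) (r2 (tr d) + r2 (tr d.+2)).
    pose rc := upd rb (tr d.+2) 1.
    pose rd := upd rc (vr x) (rc (vr x) + rc (tr d.+2)).
    pose re := upd rd (tr d.+2) 0.
    have rre : rep n (upd env x i.+1) re.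
      split=> [|y]; rewrite /re /rd /rc /rb !updE !regE; first by apply rr2.
      rewrite !(proj2 rr2) !updE; by case: (y == x); rewrite ?eqxx ?addn1.
    have ikn' : i.+1 + k = n by rewrite addSnnS.
    have [r3 [R3 rr3 v3 [k31 k32] k3]] := IHk _ _ ikn' rre.
    exists r3; split=> //.
    - rstart.
        rst; rst; rewrite updE !regE (proj1 rr1) (proj2 rr1) updE eqxx.
        have -> : (n - i == 0) = false by lia.
        have <- : ra = upd r1 (tr d.+2) (n - i).
          by rewrite /ra (proj1 rr1) (proj2 rr1) updE eqxx.
        rt R2; do 5!rst; rewrite updE !regE; exact: R3.
      lia.
    - rewrite v3 [in RHS]big_ltn; last by lia.
      by rewrite /re /rd /rc /rb !updE !regE v2 addnA k2 // /ra !updE !regE.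
    - split=> //; rewrite k31 /re /rd /rc /rb !updE !regE k2 // /ra !updE !regE //.
    - move=> d' ltd; rewrite k3 // /re /rd /rc /rb; fr ltd.
      by rewrite k2 ?leqW // /ra; fr ltd.
  pose ra := upd r (tr d) 0.
  pose rb := upd ra (tr d.+1) (ra (vr x) + ra (tr d)).
  pose rc := upd rb (vr x) 0.
  have rrc : rep n (upd env x 0) rc.
    split=> [|y]; rewrite /rc /rb /ra !updE !regE; first by apply rr.
    by case: (y == x); rewrite ?(proj2 rr).
  have [r1 [R1 rr1 v1 [k11 k12] k1]] := loop n 0 rc (add0n n) rrc.
  eexists; split.
  + rstart; first by do 3!rst; rt R1; rst; rlast.
    lia.
  + split=> [|y]; rewrite !updE !regE; first by apply rr1.
    rewrite k11 k12 addn0 /rc /rb /ra !updE !regE addn0 (proj2 rr).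
    case: eqP => [->//|/eqP/negbTE ne]; by rewrite (proj2 rr1 y) updE ne.
  + rewrite !updE !regE v1 /rc /rb /ra !updE !regE add0n big_mkord //.
  + by move=> d' ltd; fr ltd; rewrite k1 // /rc /rb /ra; fr ltd.
Qed.

Lemma comps_ok st : forall P d off n env r M,
  code_at P off (comps st d off) -> rep n env r ->
  exists r', [/\ reach P (scost st n) (Config off r M)
                  (Config (off + size (comps st d off)) r' (exec n env M st)),
    rep n env r' & forall d', d' < d -> r' (tr d') = r (tr d')].
Proof.
elim: st.
- move=> e1 e2 P d off n env r M /= c rr; dst.
  have [r1 [R1 rr1 v1 k1]] := @comp_ok e1 P d _ _ _ _ M H rr.
  have [r2 [R2 rr2 v2 k2]] := @comp_ok e2 P d.+1 _ _ _ _ M H0 rr1.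
  exists r2; split=> //.
  + rstart; first by rt R1; rt R2; rst; rewrite k2 // v1 v2; rlast.
    lia.
  + by move=> d' ltd; rewrite k2 ?k1 ?leqW.
- move=> s1 IH1 s2 IH2 P d off n env r M /= c rr; dst.
  have [r1 [R1 rr1 k1]] := IH1 P d _ _ _ _ M H rr.
  have [r2 [R2 rr2 k2]] := IH2 P d _ _ _ _ (exec n env M s1) H0 rr1.
  exists r2; split=> //.
  + by rt R1; rewrite size_cat addnA; exact: R2.
  + by move=> d' ltd; rewrite k2 ?k1.
- move=> e s1 IH1 P d off n env r M /= c rr; dst.
  have [r1 [R1 rr1 v1 k1]] := @comp_ok e P d _ _ _ _ M H rr.
  case E: (eval n env M e == 0).
    exists r1; split=> //.
    rstart; first by rt R1; rst; rewrite v1 E; rlast.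
    lia.
  have [r2 [R2 rr2 k2]] := IH1 P d _ n env r1 M ltac:(eassumption) rr1.
  exists r2; split=> //.
  + rstart; first by rt R1; rst; rewrite v1 E; rt R2; rlast.
    lia.
  + by move=> d' ltd; rewrite k2 ?k1.
- move=> x e s1 IH1 P d off n env r M /= c rr; dst.
  have [r1 [R1 rr1 v1 k1]] := @comp_ok e P d.+1 _ n env r M ltac:(eassumption) rr.
  pose ra := upd r1 (tr d) 0.
  pose rb := upd ra (tr d) (ra (vr x) + ra (tr d)).
  pose rc := upd rb (vr x) 0.
  pose rd := upd rc (vr x) (rc (tr d.+1) + rc (vr x)).
  have rrd : rep n (upd env x (eval n env M e)) rd.
    split=> [|y]; rewrite /rd /rc /rb /ra !updE !regE; first by apply rr1.
    by case: (y == x); rewrite ?v1 ?addn0 //; apply rr1.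
  have dd : rd (tr d) = env x.
    by rewrite /rd /rc /rb /ra !updE !regE addn0; apply rr1.
  have [r2 [R2 rr2 k2]] := IH1 P d.+1 _ n _ rd M ltac:(eassumption) rrd.
  eexists; split.
  + rstart; first by rt R1; do 4!rst; rt R2; do 2!rst; rlast.
    lia.
  + split=> [|y]; rewrite !updE !regE; first by apply rr2.
    rewrite addn0 k2 // dd; case: eqP => [->//|/eqP/negbTE ne].
    by rewrite (proj2 rr2 y) updE ne.
  + move=> d' ltd; fr ltd; rewrite k2 ?leqW // /rd /rc /rb /ra; fr ltd.
    by rewrite k1 ?leqW.
- move=> x s1 IH1 P d off n env r M.
  rewrite /=; set c1 := comps s1 _ _ => c rr; dst.
  have loop k i r1 M1 : i + k = n -> rep n (upd env x i) r1 -> exists r',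
    [/\ reach P (k * (scost s1 n + 6) + 2) (Config off.+3 r1 M1)
          (Config (off.+4.+1 + size c1).+4 r'
            (foldl (fun M' i => exec n (upd env x i) M' s1) M1 (iota i k))),
      rep n (upd env x n) r',
      r' (tr d) = r1 (tr d) /\ r' (tr d.+1) = 0
      & forall d', d' < d -> r' (tr d') = r1 (tr d')].
    elim: k i r1 M1 => [|k IHk] i r1 M1 ikn rr1.
      rewrite addn0 in ikn; subst i; eexists; split.
      - rst; rst; rewrite !updE !regE (proj1 rr1) (proj2 rr1) updE eqxx subnn eqxx; exact: reach0.
      - by split=> [|y]; rewrite !updE !regE; [apply rr1 | rewrite (proj2 rr1)].
      - by rewrite !updE !regE.
      - by move=> d' ltd; fr ltd.
    pose ra := upd r1 (tr d.+1) (r1 0 - r1 (vr x)).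
    have rra : rep n (upd env x i) ra.
      by split=> [|y]; rewrite /ra !updE !regE; [apply rr1 | rewrite (proj2 rr1) updE].
    have [r2 [R2 rr2 k2]] := IH1 P d.+1 _ n _ ra M1 ltac:(eassumption) rra.
    pose rc := upd r2 (tr d.+1) 1.
    pose rd := upd rc (vr x) (rc (vr x) + rc (tr d.+1)).
    pose re := upd rd (tr d.+1) 0.
    have rre : rep n (upd env x i.+1) re.
      split=> [|y]; rewrite /re /rd /rc !updE !regE; first by apply rr2.
      rewrite !(proj2 rr2) !updE; by case: (y == x); rewrite ?eqxx ?addn1.
    have ikn' : i.+1 + k = n by rewrite addSnnS.
    have [r3 [R3 rr3 [k31 k32] k3]] := IHk _ _ (exec n (upd env x i) M1 s1) ikn' rre.
    exists r3; split=> //.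
    - rstart.
        rst; rst; rewrite updE !regE (proj1 rr1) (proj2 rr1) updE eqxx.
        have -> : (n - i == 0) = false by lia.
        have <- : ra = upd r1 (tr d.+1) (n - i).
          by rewrite /ra (proj1 rr1) (proj2 rr1) updE eqxx.
        rt R2; do 4!rst; rewrite updE !regE; exact: R3.
      lia.
    - split=> //; rewrite k31 /re /rd /rc !updE !regE k2 // /ra !updE !regE //.
    - move=> d' ltd; rewrite k3 // /re /rd /rc; fr ltd.
      by rewrite k2 ?leqW // /ra; fr ltd.
  pose ra := upd r (tr d) 0.
  pose rb := upd ra (tr d) (ra (vr x) + ra (tr d)).
  pose rc := upd rb (vr x) 0.
  have rrc : rep n (upd env x 0) rc.
    split=> [|y]; rewrite /rc /rb /ra !updE !regE; first by apply rr.
    by case: (y == x); rewrite ?(proj2 rr).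
  have [r1 [R1 rr1 [k11 k12] k1]] := loop n 0 rc M (add0n n) rrc.
  eexists; split.
  + rstart; first by do 3!rst; rt R1; rst; rlast.
    lia.
  + split=> [|y]; rewrite !updE !regE; first by apply rr1.
    rewrite k11 k12 addn0 /rc /rb /ra !updE !regE addn0 (proj2 rr).
    case: eqP => [->//|/eqP/negbTE ne]; by rewrite (proj2 rr1 y) updE ne.
  + by move=> d' ltd; fr ltd; rewrite k1 // /rc /rb /ra; fr ltd.
Qed.

(** Register 0 first receives N from cell 0, so that [e] is evaluated with loop bound N; the value
    of [e] then becomes the loop bound of [st]. *)
Definition prog (e : expr) (st : stmt) : seq instr :=
  let c0 := comp e 1 2 in
  let off := size c0 + 4 in
  [:: IConst (tr 0) 0; ILoad 0 (tr 0)] ++ c0 ++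
  [:: IConst (tr 0) 0; IAdd 0 (tr 1) (tr 0)] ++ comps st 0 off.

Lemma prog_ok e st M n l : M 0 = n -> l = eval n (fun _ => 0) M e ->
  exists r', reach (prog e st) (ecost e n + scost st l + 4) (Config 0 (fun _ => 0) M)
    (Config (size (prog e st)) r' (exec l (fun _ => 0) M st)).
Proof.
move=> M0 lE; have : code_at (prog e st) 0 (prog e st).
  by have := code_at_self [::] (prog e st) [::]; rewrite cats0.
rewrite {2}/prog => c; cbn -[code_at comp comps] in c; dst.
pose ra := upd (fun _ => 0) (tr 0) 0; pose rb := upd ra 0 (M (ra (tr 0))).
have rrb : rep n (fun _ => 0) rb.
  by split=> [|y]; rewrite /rb /ra !updE !regE // -M0.
have [r1 [R1 rr1 v1 k1]] := @comp_ok e _ _ _ _ _ _ M H1 rrb.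
pose rc := upd r1 (tr 0) 0; pose rd := upd rc 0 (rc (tr 1) + rc (tr 0)).
have rrd : rep l (fun _ => 0) rd.
  split=> [|y]; rewrite /rd /rc !updE !regE; first by rewrite addn0 v1.
  by apply rr1.
have E : (2 + size (comp e 1 2)).+2 = size (comp e 1 2) + 4 by lia.
rewrite E in H4.
have [r2 [R2 rr2 k2]] := @comps_ok st _ _ _ _ _ _ M H4 rrd.
exists r2; rstart; first by rst; rst; rt R1; rst; rst; rewrite E; rt R2; rlast.
lia.
Qed.

Lemma polybX f k : polyb f -> polyb (fun n => f n ^ k).
Proof.
move=> pf; elim: k => [|k IH]; first exact: polyb_const.
have [c [d h]] := polybM pf IH; exists c, d => n; rewrite expnS; exact: h.
Qed.

Lemma polyb_comp f g : polyb f -> polyb g -> polyb (fun n => f (g n)).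
Proof.
move=> [c [k fP]] pg.
have [c' [k' h]] := polybM (polyb_const c) (polybX k (polybD pg (polyb_const 1))).
exists c', k' => n; apply: leq_trans (h n); rewrite addn1; exact: fP.
Qed.

(** The power is obtained from nested sums of 1, without multiplication. *)
Definition epow m := iter m (ESum 0) (EC 1).

Lemma eval_epow n m env M : eval n env M (epow m) = n ^ m.
Proof.
elim: m env => //= m IH env; rewrite expnS.
by rewrite (eq_bigr (fun _ => n ^ m)) ?sum_nat_const ?card_ord.
Qed.

Lemma prog_poly m st : exists d k, forall M n, M 0 = n ->
  let cf := run (prog (epow m) st) (d * n.+1 ^ k) (Config 0 (fun _ => 0) M) in
  halted (prog (epow m) st) cf /\ Defs.mem cf = exec (n ^ m) (fun _ => 0) M st.
Proof.
have [d [k h]] : polyb (fun n => ecost (epow m) n + scost st (n ^ m) + 4).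
  apply: polybD (polyb_const _); apply: polybD (polyb_ecost _) _.
  exact: polyb_comp (polyb_scost _) (polybX _ polyb_id).
exists d, k => M n M0 cf.
have lE : n ^ m = eval n (fun _ => 0) M (epow m) by rewrite eval_epow.
have [r' [t lt rt]] := prog_ok st M0 lE.
have hlt : step (prog (epow m) st) (run (prog (epow m) st) t (Config 0 (fun _ => 0) M)) = None.
  by rewrite rt /step ltnn.
(* The program halts by running off its end, so the steps left in the budget change nothing. *)
have -> : cf = run (prog (epow m) st) t (Config 0 (fun _ => 0) M).
  rewrite /cf; have -> : d * n.+1 ^ k = t + (d * n.+1 ^ k - t).
    by rewrite subnKC // (leq_trans lt).
  by rewrite run_add run_halted.
by rewrite /halted hlt rt.
Qed.

(** * The approximation program *)

Definition ENot e := EIf e (EC 0) (EC 1).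
Definition EAnd e1 e2 := EIf e1 e2 (EC 0).
Definition EOr e1 e2 := EIf e1 (EC 1) e2.
Definition ELt e1 e2 := ESub e2 e1.
Definition EEq e1 e2 := ENot (EAdd (ESub e1 e2) (ESub e2 e1)).
Definition ECount x e := ESum x (EIf e (EC 1) (EC 0)).
Definition EAll := foldr EAnd (EC 1).
Definition EAny := foldr EOr (EC 0).
Definition EMulC c e := iter c (EAdd e) (EC 0).

Notation holds n env M e := (eval n env M e != 0).

Section Truth.
Variables (n : nat) (env M : nat -> nat).

Lemma holds_not e : holds n env M (ENot e) = ~~ holds n env M e.
Proof. by rewrite /=; case: (eval _ _ _ _ == 0). Qed.

Lemma holds_and e1 e2 : holds n env M (EAnd e1 e2) = holds n env M e1 && holds n env M e2.
Proof. by rewrite /=; case: (eval _ _ _ _ == 0). Qed.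

Lemma holds_lt e1 e2 : holds n env M (ELt e1 e2) = (eval n env M e1 < eval n env M e2).
Proof. by rewrite /= subn_eq0 -ltnNge. Qed.

Lemma holds_eq e1 e2 : holds n env M (EEq e1 e2) = (eval n env M e1 == eval n env M e2).
Proof. by rewrite holds_not negbK /= addn_eq0 !subn_eq0 eqn_leq. Qed.

Lemma holds_all (T : Type) (E : T -> expr) l :
  holds n env M (EAll [seq E i | i <- l]) = all (fun i => holds n env M (E i)) l.
Proof. by elim: l => //= i l <-; case: (eval _ _ _ (E i) == 0). Qed.

Lemma holds_any (T : Type) (E : T -> expr) l :
  holds n env M (EAny [seq E i | i <- l]) = has (fun i => holds n env M (E i)) l.
Proof. by elim: l => //= i l <-; case: (eval _ _ _ (E i) == 0). Qed.

Lemma eval_count x e :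
  eval n env M (ECount x e) = #|[set i : 'I_n | holds n (upd env x i) M e]|.
Proof.
rewrite /= -sum1_card [RHS]big_mkcond; apply: eq_bigr => i _; rewrite inE.
by case: (eval _ _ _ _ == 0).
Qed.

Lemma holds_count x e :
  holds n env M (ECount x e) = [exists i : 'I_n, holds n (upd env x i) M e].
Proof.
rewrite eval_count cards_eq0; apply/set0Pn/existsP => -[i]; rewrite ?inE => h; exists i => //.
by rewrite inE.
Qed.

Lemma eval_mulC c e : eval n env M (EMulC c e) = c * eval n env M e.
Proof. by elim: c => //= c ->; rewrite mulSn. Qed.

(** Simulation rule: a loop on memory is followed by a [foldl] on an abstract state, which below is
    a set of facts. *)
Lemma exec_for (T : Type) (R : (nat -> nat) -> T -> Prop) (f : T -> 'I_n -> T) x body t :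
  R M t ->
  (forall (i : 'I_n) M' t', R M' t' -> R (exec n (upd env x i) M' body) (f t' i)) ->
  R (exec n env M (SFor x body)) (foldl f t (enum 'I_n)).
Proof.
move=> + RS; rewrite /= -val_enum_ord.
elim: (enum 'I_n) M t => //= i r IH M' t' R'; apply: IH; exact: RS.
Qed.

Lemma exec_if c s : exec n env M (SIf c s) = if holds n env M c then exec n env M s else M.
Proof. by rewrite /=; case: (eval _ _ _ _ == 0). Qed.
End Truth.

Lemma card_lt_ord n q : q <= n -> #|[set i : 'I_n | i < q]| = q.
Proof.
move=> qn; rewrite -[RHS]card_ord -sum1_card -[RHS]sum1_card.
by rewrite (big_ord_widen n (fun=> 1) qn); apply: eq_bigl => i; rewrite inE.
Qed.

(** * The text of the program *)

Section Program.
Variables (a m : nat) (schema : 'I_m -> {set 'I_a}) (head : {set 'I_a}).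
Variables (B : 'I_a) (i0 : 'I_m).

(* A witness is a number x < N ^ m whose base-N digits index m facts, one per
   relation.  Variable 0 holds a witness, 1 a fact index, 2 a second witness,
   3 the fact under scrutiny, 4 the value of B, 6 the threshold; the operand of
   [EMulN] must not mention variable 9. *)
Definition EN := ELd (EC 0).
(** The loop runs to the common bound [n >= N], and the guard makes exactly N of its terms count. *)
Definition EMulN e := ESum 9 (EIf (ELt (EV 9) EN) e (EC 0)).
(** The quotient of variable 0 by N, as the number of positive multiples of N that do not exceed
    it. *)
Definition Quot := ECount 8 (ENot (ESub (EMulN (EAdd (EC 1) (EV 8))) (EV 0))).
Definition Dig (i : nat) :=
  iter i (ELet 0 Quot) (ESub (EV 0) (ELet 1 Quot (EMulN (EV 1)))).
Definition Fld c := ELd (EAdd (EC c.+1) (EMulC a.+1 (EV 1))).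

(** The relation in which the value of attribute [k] is looked up; [Valid] checks that the other
    relations agree with it. The default is reached only outside [attrQ]. *)
Definition rho (k : 'I_a) : 'I_m := odflt i0 [pick i | k \in schema i].
Definition Val (k : 'I_a) := ELet 1 (Dig (rho k)) (Fld k.+1).
Definition Valid := EAll [seq
  EAnd (EEq (ELet 1 (Dig i) (Fld 0)) (EC i))
       (EAll [seq EEq (ELet 1 (Dig i) (Fld k.+1)) (Val k) | k : 'I_a <- enum (schema i)])
  | i : 'I_m <- enum 'I_m].
Definition Same := EAll [seq EEq (Val k) (ELet 0 (EV 2) (Val k)) | k : 'I_a <- enum head].
Definition KBase := EAdd (EC 1) (EMulC a.+1 EN).
Definition ABase := EAdd KBase EL.
Definition IB := [seq i <- enum 'I_m | B \in schema i].
Definition NB := [seq i <- enum 'I_m | B \notin schema i].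
Definition InAll base := EAll [seq ELd (EAdd base (Dig i)) | i : 'I_m <- IB].
Definition Uses (l : seq 'I_m) := EAny [seq EEq (Dig i) (EV 3) | i : 'I_m <- l].
Definition Cov :=
  ECount 2 (EAnd (ELet 0 (EV 2) Valid) (EAnd Same (ELet 0 (EV 2) (InAll KBase)))).
Definition Deg := ECount 0 (EAnd
  (EAnd Valid (EAnd (EEq (Val B) (EV 4)) (EAnd (ENot Cov) (InAll ABase))))
  (Uses IB)).
Definition Flag base := EAdd base (EV 3).

Definition Init := SFor 3 (SSt (Flag ABase) (EC 1)).
Definition Peel := SFor 3 (SIf (ELt Deg (EV 6)) (SSt (Flag ABase) (EC 0))).
Definition Keep := SFor 3 (SIf (ELd (Flag ABase)) (SSt (Flag KBase) (EC 1))).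
(** The values of B are read off all witnesses, valid or not and with repetitions, which avoids
    listing the distinct ones. A value taken by no valid witness has no edges, hence an empty
    core. *)
Definition Level :=
  SFor 7 (SLet 4 (ELet 0 (EV 7) (Val B)) (SSeq Init (SSeq (SFor 5 Peel) Keep))).
Definition Greedy := SFor 8 (SLet 6 (ESub EL (EV 8)) Level).
Definition Forced :=
  SFor 3 (SIf (ECount 0 (EAnd Valid (Uses NB))) (SSt (Flag KBase) (EC 1))).
(** Cell 0 is about to be overwritten, so N and the base of the flags are saved in variables. From
    then on [EN] reads the number of indices output, which after the increment is also the address
    of the next one. *)
Definition Output :=
  SLet 10 EN (SLet 11 KBase (SSeq (SSt (EC 0) (EC 0))
    (SFor 3 (SIf (EAnd (ELt (EV 3) (EV 10)) (ELd (Flag (EV 11))))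
      (SSeq (SSt (EC 0) (EAdd (EC 1) EN)) (SSt EN (EV 3))))))).
Definition Main := SSeq Greedy (SSeq Forced Output).


(** * Execution on an encoded database *)

Section Run.
Variable s : seq (fact a m).
Let N := size s.
Let n := N ^ m.

Definition fld j c := encode s (c.+1 + a.+1 * j).
Definition dig i x := (x %/ N ^ i) %% N.
Definition aval k x := fld (dig (rho k) x) k.+1.
Definition validb x :=
  all (fun i : 'I_m => (fld (dig i x) 0 == i) &&
    all (fun k : 'I_a => fld (dig i x) k.+1 == aval k x) (enum (schema i))) (enum 'I_m).
Definition sameb x y := all (fun k => aval k x == aval k y) (enum head).
(** Facts are numbered in ['I_n] because all loops run to [n]; a number from N on is never a digit
    of a witness. *)
Definition uses l (x : 'I_n) : {set 'I_n} := [set j : 'I_n | has (fun i : 'I_m => dig i x == j) l].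

(* Above the input, cells [kb .. kb + n - 1] flag the kept facts and the next [n]
   cells those that survive the current peeling. *)
Definition inp (M : nat -> nat) := forall y, y <= a.+1 * N -> M y = encode s y.
Definition kb := (a.+1 * N).+1.
Definition flags b (M : nat -> nat) := [set j : 'I_n | M (b + j) != 0].

Lemma leNn : N <= n.
Proof.
rewrite /n; case: N => // k; case: m i0 => [[]//|m' _].
by rewrite expnS leq_pmulr // expn_gt0.
Qed.

Lemma N_gt0 x : x < n -> 0 < N.
Proof. by rewrite /n; case: N m i0 => [|k] [[]//|m' _] //; rewrite exp0n. Qed.

Lemma dig_lt i x : x < n -> dig i x < N.
Proof. by move=> /N_gt0 N0; rewrite ltn_mod. Qed.

Lemma dig_ltn i x : x < n -> dig i x < n.
Proof. by move=> h; apply: leq_trans (dig_lt i h) leNn. Qed.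

Section Mem.
Variable M : nat -> nat.
Hypothesis inpM : inp M.

Let M0 : M 0 = N. Proof. by rewrite inpM. Qed.

Lemma eval_mulN env e v : (forall i, eval n (upd env 9 i) M e = v) ->
  eval n env M (EMulN e) = N * v.
Proof.
move=> ev; rewrite /EMulN [LHS]/= M0.
rewrite (eq_bigr (fun i : 'I_n => if i < N then v else 0)); last first.
  by move=> i _; rewrite ev /upd eqxx subn_eq0 ltnNge; case: leq.
by rewrite -big_mkcond /= sum_nat_cond_const -{2}(card_lt_ord leNn) cardsE.
Qed.

Opaque EMulN.

Lemma eval_quot env : env 0 < n -> eval n env M Quot = env 0 %/ N.
Proof.
move=> e0; rewrite eval_count -[RHS](@card_lt_ord n); last first.
  by apply: leq_trans (leq_div _ _) (ltnW e0).
  apply: eq_card => i; rewrite !inE holds_not negbK /= (@eval_mulN _ _ (i.+1)) => [|j].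
  by rewrite /= /upd /= subn_eq0 mulnC -leq_divRL // (N_gt0 e0).
by [].
Qed.

Opaque Quot.

Lemma eval_dig i env : env 0 < n -> eval n env M (Dig i) = dig i (env 0).
Proof.
move=> e0; have N0 := N_gt0 e0; rewrite /dig.
elim: i env e0 => [|i IH] env e0.
  rewrite /Dig [LHS]/= -/Quot; rewrite (@eval_mulN _ _ (env 0 %/ N)) => [|j].
    by rewrite expn0 divn1 {1}(divn_eq (env 0) N) mulnC addKn.
  by rewrite [LHS]/= -(eval_quot e0).
rewrite /Dig iterS -/(Dig i) [LHS]/= IH; last first.
  by rewrite /upd /= eval_quot //; apply: leq_ltn_trans (leq_div _ _) e0.
by rewrite /upd /= eval_quot // -divnMA expnS.
Qed.

Opaque Dig.

Lemma eval_fld c env : env 1 < N -> c <= a -> eval n env M (Fld c) = fld (env 1) c.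
Proof.
move=> e1 ca; rewrite /Fld [LHS]/= -/(EMulC a (EV 1)) eval_mulC /= inpM ?addnS //.
have h : a.+1 * (env 1).+1 <= a.+1 * N by rewrite leq_mul2l e1 orbT.
by lia.
Qed.

Opaque Fld.

Lemma eval_fdig (i : nat) c env : env 0 < n -> c <= a ->
  eval n env M (ELet 1 (Dig i) (Fld c)) = fld (dig i (env 0)) c.
Proof.
by move=> e0 ca; rewrite [LHS]/= eval_fld // /upd /= eval_dig ?dig_lt.
Qed.

Lemma eval_val k env : env 0 < n -> eval n env M (Val k) = aval k (env 0).
Proof. by move=> e0; rewrite eval_fdig. Qed.

Opaque Val.

Lemma holds_valid env : env 0 < n -> holds n env M Valid = validb (env 0).
Proof.
move=> e0; rewrite holds_all; apply: eq_all => i.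
rewrite holds_and holds_eq eval_fdig //; congr (_ && _).
by rewrite holds_all; apply: eq_all => k; rewrite holds_eq eval_fdig // eval_val.
Qed.

Opaque Valid.

Lemma holds_same env : env 0 < n -> env 2 < n ->
  holds n env M Same = sameb (env 0) (env 2).
Proof.
move=> e0 e2; rewrite holds_all; apply: eq_all => k.
by rewrite holds_eq eval_val // [eval _ _ _ (ELet _ _ _)]/= eval_val.
Qed.

Opaque Same.

Lemma eval_kbase env : eval n env M KBase = kb.
Proof. by rewrite [LHS]/= -/(EMulC a EN) eval_mulC /= M0. Qed.

Opaque KBase.

Lemma eval_abase env : eval n env M ABase = kb + n.
Proof. by rewrite [LHS]/= eval_kbase. Qed.

Opaque ABase.

Lemma holds_inall base b (env : nat -> nat) (x : 'I_n) : (forall env, eval n env M base = b) ->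
  env 0 = x -> holds n env M (InAll base) = (uses IB x \subset flags b M).
Proof.
move=> baseE e0; rewrite holds_all.
have E i : eval n env M (ELd (EAdd base (Dig i))) = M (b + dig i x).
  by rewrite [LHS]/= baseE eval_dig e0.
apply/allP/subsetP => h j.
  by rewrite !inE => /hasP[i iB /eqP <-]; have := h i iB; rewrite E.
move=> jB; rewrite E; have := h (Ordinal (dig_ltn j (ltn_ord x))).
by rewrite !inE; apply; apply/hasP; exists j.
Qed.

Opaque InAll.

Lemma holds_uses l (env : nat -> nat) (x j : 'I_n) : env 0 = x -> env 3 = j ->
  holds n env M (Uses l) = (j \in uses l x).
Proof.
move=> e0 e3; rewrite holds_any inE; apply: eq_has => i.
by rewrite holds_eq eval_dig e0 //= e3.
Qed.

Opaque Uses.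

Let vO (x : 'I_n) := validb x.
Let sO (x y : 'I_n) := sameb x y.
Let bO (x : 'I_n) := aval B x.

Lemma holds_cov (env : nat -> nat) (x : 'I_n) : env 0 = x ->
  holds n env M Cov = cov vO sO (uses IB) (flags kb M) x.
Proof.
move=> e0; rewrite holds_count; apply: eq_existsb => y.
rewrite !holds_and [eval _ _ _ (ELet _ _ Valid)]/= [eval _ _ _ (ELet _ _ (InAll _))]/=.
have ly := ltn_ord y; have lx := ltn_ord x.
rewrite holds_valid ?holds_same ?(@holds_inall _ kb _ y) /upd /= ?e0 //; exact: eval_kbase.
Qed.

Opaque Cov.

Lemma eval_deg (env : nat -> nat) (j : 'I_n) : env 3 = j ->
  eval n env M Deg = deg vO sO bO (uses IB) (flags kb M) (flags (kb + n) M) (env 4) j.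
Proof.
move=> e3; rewrite eval_count; apply: eq_card => x; rewrite !inE.
have lx := ltn_ord x.
rewrite !holds_and holds_valid ?holds_eq ?eval_val ?holds_not ?(@holds_cov _ x) //.
rewrite (@holds_inall _ (kb + n) _ x) //; last exact: eval_abase.
by rewrite (@holds_uses _ _ x j) // !inE.
Qed.

Opaque Deg.

End Mem.

Opaque EMulN Quot Dig Fld Val Valid Same KBase ABase InAll Uses Cov Deg.

Let vO (x : 'I_n) := validb x.
Let sO (x y : 'I_n) := sameb x y.
Let bO (x : 'I_n) := aval B x.

Definition Inv M K A := [/\ inp M, flags kb M = K & flags (kb + n) M = A].

Lemma inp_upd M y v : inp M -> kb <= y -> inp (upd M y v).
Proof.
by move=> iM kby z zN; rewrite /upd ltn_eqF ?iM //; apply: leq_trans kby.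
Qed.

Lemma flags_upd b M (j : 'I_n) v :
  flags b (upd M (b + j) v) = if v == 0 then flags b M :\ j else j |: flags b M.
Proof.
apply/setP => t; rewrite inE /upd eqn_add2l.
have -> : (nat_of_ord t == j) = (t == j) by [].
by have [->|v0] := eqVneq v 0; rewrite !inE; case: (t == j).
Qed.

Lemma flags_upd_out b M y v : (y < b) || (b + n <= y) -> flags b (upd M y v) = flags b M.
Proof.
move=> yP; apply/setP => t; rewrite !inE /upd; case: (b + t =P y) => // e.
have yb : b <= y by rewrite -e leq_addr.
have yn : y < b + n by rewrite -e ltn_add2l.
by move: yP; rewrite ltnNge yb leqNgt yn.
Qed.

Lemma Inv_setA M K A (j : 'I_n) v : Inv M K A ->
  Inv (upd M (kb + n + j) v) K (if v == 0 then A :\ j else j |: A).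
Proof.
move=> [iM KE AE]; split; last by rewrite flags_upd AE.
  by apply: inp_upd => //; rewrite -addnA leq_addr.
by rewrite flags_upd_out // leq_addr orbT.
Qed.

Lemma Inv_setK M K A (j : 'I_n) : Inv M K A -> Inv (upd M (kb + j) 1) (j |: K) A.
Proof.
move=> [iM KE AE]; split; first by apply: inp_upd => //; rewrite leq_addr.
  by rewrite flags_upd KE.
by rewrite flags_upd_out // ltn_add2l ltn_ord.
Qed.

Lemma foldl_setU1 (T : finType) (P : pred T) (K : {set T}) :
  foldl (fun K j => if P j then j |: K else K) K (enum T) = K :|: [set j | P j].
Proof.
have -> : [set j | P j] = [set j in enum T | P j] by apply/setP => j; rewrite !inE mem_enum.
elim: (enum T) K => [|j r IH] K /=; first by apply/setP => i; rewrite !inE orbF.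
rewrite IH; apply/setP => i; case: ifP => Pj; rewrite !inE.
  by case: eqP => [->|]; rewrite ?Pj ?orbT ?orbF //= orbCA.
by case: eqP => [->|]; rewrite ?Pj ?andbF.
Qed.

Lemma foldl_iter (T U : Type) (f : U -> U) t (r : seq T) :
  foldl (fun t _ => f t) t r = iter (size r) f t.
Proof. by elim: r t => //= i r IH t; rewrite IH -iterSr. Qed.

Lemma exec_flag M (env : nat -> nat) base b v (j : 'I_n) : (forall env, eval n env M base = b) ->
  env 3 = j -> exec n env M (SSt (Flag base) (EC v)) = upd M (b + j) v.
Proof. by move=> h e3; rewrite /= h e3. Qed.

Lemma eval_flag M (env : nat -> nat) base b (j : 'I_n) :
  (forall env, eval n env M base = b) -> env 3 = j ->
  eval n env M (ELd (Flag base)) = M (b + j).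
Proof. by move=> h e3; rewrite /= h e3. Qed.

Lemma exec_init M K A env : Inv M K A -> Inv (exec n env M Init) K setT.
Proof.
move=> iM; rewrite (_ : setT = A :|: [set j | xpredT j]); last first.
  by apply/setP => j; rewrite !inE orbT.
rewrite -foldl_setU1; apply: (exec_for (R := fun M A => Inv M K A)) => // j M' A' iM'.
rewrite (@exec_flag _ _ _ (kb + n) _ j) //; first exact: (Inv_setA j 1).
by move=> e; apply: eval_abase; case: iM'.
Qed.

Lemma exec_peel M K A env : Inv M K A ->
  Inv (exec n env M Peel) K (foldl (peel vO sO bO (uses IB) K (env 4) (env 6)) A (enum 'I_n)).
Proof.
move=> iM; apply: (exec_for (R := fun M A => Inv M K A)) => // j M' A' iM'; have [inpM KE AE] := iM'.
rewrite exec_if; have -> : holds n (upd env 3 j) M' (ELt Deg (EV 6))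
    = (deg vO sO bO (uses IB) K A' (env 4) j < env 6).
  by rewrite holds_lt (@eval_deg _ inpM _ j) // KE AE.
rewrite /peel.
case: ifP => // _; rewrite (@exec_flag _ _ _ (kb + n) _ j) //; first exact: (Inv_setA j 0).
by move=> e; exact: eval_abase.
Qed.

Lemma exec_keep M K A env : Inv M K A -> Inv (exec n env M Keep) (K :|: A) A.
Proof.
move=> iM; rewrite (_ : K :|: A = K :|: [set j | j \in A]); last first.
  by congr (_ :|: _); apply/setP => j; rewrite inE.
rewrite -foldl_setU1; apply: (exec_for (R := fun M K => Inv M K A)) => // j M' K' iM'; have [inpM KE AE] := iM'.
rewrite exec_if; have -> : holds n (upd env 3 j) M' (ELd (Flag ABase)) = (j \in A).
  rewrite (@eval_flag _ _ _ (kb + n) j) //; last by move=> e; exact: eval_abase.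
  by rewrite -AE inE.
case: ifP => // _; rewrite (@exec_flag _ _ _ kb _ j) //; first exact: Inv_setK.
exact: eval_kbase.
Qed.

Opaque Init Peel Keep.

(** The final peeling flags are left existential, since [Init] resets them before the next core. *)
Lemma exec_level M K A env : Inv M K A -> exists A',
  Inv (exec n env M Level) (level vO sO bO (uses IB) n [seq bO x | x : 'I_n] K (env 6)) A'.
Proof.
move=> iM; rewrite /level /image_mem.
have -> : forall f t, foldl f t [seq bO x | x <- enum 'I_n] = foldl (fun (K : {set 'I_n}) x => f K (bO x)) t (enum 'I_n).
  by move=> f t; elim: (enum _) t => /=.
apply: (exec_for (R := fun M K => exists A, Inv M K A)); first by exists A.
move=> x M' K' [A1 iM']; exists (core vO sO bO (uses IB) n K' (bO x) (env 6)).
have [inpM _ _] := iM'.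
set env1 := upd env 7 x.
have -> : exec n env1 M' (SLet 4 (ELet 0 (EV 7) (Val B)) (SSeq Init (SSeq (SFor 5 Peel) Keep)))
    = let env2 := upd env1 4 (bO x) in
      exec n env2 (exec n env2 (exec n env2 M' Init) (SFor 5 Peel)) Keep.
  by rewrite [LHS]/= eval_val //= ltn_ord.
apply: exec_keep.
have -> : core vO sO bO (uses IB) n K' (bO x) (env 6) =
    foldl (fun A _ => foldl (peel vO sO bO (uses IB) K' (bO x) (env 6)) A (enum 'I_n))
      setT (enum 'I_n).
  by rewrite (foldl_iter (fun A => foldl _ A _)) size_enum_ord.
apply: (exec_for (R := fun M A => Inv M K' A)); first exact: exec_init iM'.
by move=> r M2 A2 iM2; apply: exec_peel.
Qed.

Opaque Level.

Lemma exec_greedy M env : inp M -> flags kb M = set0 -> exists A',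
  Inv (exec n env M Greedy)
    (greedy vO sO bO (uses IB) n [seq bO x | x : 'I_n] n n) A'.
Proof.
move=> iM K0; rewrite /greedy -val_enum_ord.
have -> : forall (f : {set _} -> nat -> {set _}) (t : {set 'I_n}), foldl f t [seq val i | i <- enum 'I_n] = foldl (fun K x => f K (val x)) t (enum 'I_n).
  by move=> f t; elim: (enum _) t => /=.
apply: (exec_for (R := fun M K => exists A, Inv M K A)); first by exists (flags (kb + n) M).
move=> x M' K' [A1 iM']; exact: exec_level iM'.
Qed.

Definition forced := [set j : 'I_n | [exists x : 'I_n, validb x && (j \in uses NB x)]].

Lemma exec_forced M K A env : Inv M K A -> Inv (exec n env M Forced) (K :|: forced) A.
Proof.
move=> iM; rewrite -foldl_setU1.
apply: (exec_for (R := fun M K => Inv M K A)) => // j M' K' iM'; have [inpM KE AE] := iM'.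
rewrite exec_if holds_count.
rewrite (_ : [exists i, _] = [exists x : 'I_n, validb x && (j \in uses NB x)]); last first.
  apply: eq_existsb => x; have lx := ltn_ord x.
  by rewrite holds_and holds_valid ?(@holds_uses _ _ _ _ x j).
case: ifP => // _; rewrite (@exec_flag _ _ _ kb _ j) //; first exact: Inv_setK.
by move=> e; exact: eval_kbase.
Qed.

Definition selected M := [seq j <- iota 0 n | (j < N) && (M (kb + j) != 0)].

(** Hence the output occupies cells up to N at most, all below [kb], and never destroys a flag that
    is still to be read. *)
Lemma size_selected M t : size [seq j <- iota 0 t | (j < N) && (M (kb + j) != 0)] <= N.
Proof.
rewrite -[leqRHS](size_iota 0); apply: uniq_leq_size; first by rewrite filter_uniq ?iota_uniq.
by move=> j; rewrite mem_filter !mem_iota => /andP[/andP[-> _] _].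
Qed.

Lemma exec_output M env : inp M ->
  let M' := exec n env M Output in
  [seq M' i.+1 | i <- iota 0 (M' 0)] = selected M.
Proof.
move=> iM M1; rewrite {}/M1; set sel := fun t => [seq j <- iota 0 t | (j < N) && (M (kb + j) != 0)].
have kbE := eval_kbase iM.
set e2 := upd (upd env 10 N) 11 kb.
set body := SIf (EAnd (ELt (EV 3) (EV 10)) (ELd (Flag (EV 11))))
      (SSeq (SSt (EC 0) (EAdd (EC 1) EN)) (SSt EN (EV 3))).
have -> : exec n env M Output = foldl (fun M' i => exec n (upd e2 3 i) M' body) (upd M 0 0) (iota 0 n).
  by rewrite [LHS]/= kbE iM.
pose R M' t := [/\ M' 0 = size (sel t), [seq M' i.+1 | i <- iota 0 (size (sel t))] = sel t
  & forall y, kb <= y -> M' y = M y].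
suff h t : R (foldl (fun M' i => exec n (upd e2 3 i) M' body) (upd M 0 0) (iota 0 t)) t.
  by have [-> -> _] := h n.
elim: t => [|t [IH0 IH1 IH2]].
  by split=> // y kby; rewrite /= /upd gtn_eqF //; apply: leq_trans kby.
rewrite -[t.+1]addn1 iotaD foldl_cat add0n; move: IH0 IH1 IH2.
set F := fun M' i => _; set M1 := foldl F _ _ => IH0 IH1 IH2.
rewrite [foldl F M1 _](_ : _ = exec n (upd e2 3 t) M1 body) //.
have selS : sel (t + 1) = if (t < N) && (M (kb + t) != 0) then rcons (sel t) t else sel t.
  rewrite /sel iotaD filter_cat add0n /=; case: ifP => _; last by rewrite cats0.
  by rewrite cats1.
have -> : exec n (upd e2 3 t) M1 body =
  if (t < N) && (M (kb + t) != 0) then upd (upd M1 0 (M1 0).+1) (M1 0).+1 t else M1.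
  rewrite exec_if holds_and holds_lt; congr (if _ && _ then _ else _).
  by rewrite -IH2 ?leq_addr.
have := size_selected M (t + 1); rewrite -/(sel _) /R selS; case: ifP => // _.
rewrite size_rcons -IH0 => leN; split=> //.
- have -> : iota 0 (M1 0).+1 = iota 0 (M1 0) ++ [:: M1 0] by rewrite -addn1 iotaD.
  rewrite map_cat -cats1.
  congr (_ ++ _); last by rewrite /= /upd eqxx.
  rewrite -[RHS]IH1 -IH0; apply/eq_in_map => i; rewrite mem_iota => /andP[_ il].
  by rewrite /upd /= eqSS ltn_eqF.
- move=> y kby; have lty : (M1 0).+1 < y.
    by apply: leq_trans kby; rewrite ltnS; apply: leq_trans leN _; rewrite leq_pmull.
  have y0 : 0 < y by apply: leq_ltn_trans lty.
  by rewrite /upd (gtn_eqF lty) (gtn_eqF y0) IH2.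
Qed.

(** * Reading facts back from the encoding *)

Let f0 : fact a m := (i0, [ffun=> 0]).
Let fct j := nth f0 s j.

Lemma nth_flatten_const (T : Type) (x0 : T) (E : T -> seq nat) w (r : seq T) c j :
  (forall f, size (E f) = w) -> c < w -> j < size r ->
  nth 0 (flatten [seq E f | f <- r]) (c + w * j) = nth 0 (E (nth x0 r j)) c.
Proof.
move=> Ew cw; elim: r j => //= f r IH [|j] jr; first by rewrite muln0 addn0 nth_cat Ew cw.
by rewrite nth_cat Ew mulnS addnCA ltnNge leq_addr /= addKn IH.
Qed.

Lemma size_encode_fact (f : fact a m) : size (encode_fact f) = a.+1.
Proof. by rewrite /= size_map size_enum_ord. Qed.

Lemma fld_fct c j : j < N -> c < a.+1 -> fld j c = nth 0 (encode_fact (fct j)) c.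
Proof.
by move=> jN ca; rewrite /fld /encode addSn /= (nth_flatten_const f0 size_encode_fact).
Qed.

Lemma fld_rel j : j < N -> fld j 0 = (fct j).1.
Proof. by move=> jN; rewrite fld_fct. Qed.

Lemma fld_attr j (k : 'I_a) : j < N -> fld j k.+1 = (fct j).2 k.
Proof.
move=> jN; rewrite fld_fct ?ltnS //=.
by rewrite (nth_map k) ?size_enum_ord // nth_ord_enum.
Qed.

Lemma inp_encode : inp (encode s).
Proof. by []. Qed.

Lemma flags_encode : flags kb (encode s) = set0.
Proof.
apply/setP => j; rewrite !inE /encode nth_default //= size_flatten /shape -map_comp.
have h (r : seq (fact a m)) : sumn [seq (size \o @encode_fact a m) f | f <- r] = a.+1 * size r.
  by elim: r => [|f r IH]; rewrite ?muln0 //= IH size_map size_enum_ord mulnS.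
by rewrite h ltnS leq_addr.
Qed.

Let G := greedy vO sO bO (uses IB) n [seq bO x | x : 'I_n] n n.

Lemma exec_main : let M := exec n (fun _ => 0) (encode s) Main in
  let out := [seq M i.+1 | i <- iota 0 (M 0)] in
  uniq out /\ forall j, (j \in out) = (j < N) && (j \in [seq val t | t in G :|: forced]).
Proof.
have [A iG] := exec_greedy (fun=> 0) inp_encode flags_encode.
have [iM KE _] := exec_forced (fun=> 0) iG.
move=> M out; have outE : out = selected (exec n (fun=> 0) (exec n (fun=> 0) (encode s) Greedy) Forced).
  exact: exec_output.
rewrite outE /selected filter_uniq ?iota_uniq; split=> // j.
rewrite mem_filter mem_iota add0n /= -KE -andbA; congr (_ && _).
apply/andP/imageP => [[fj jn]|[t + ->]]; first by exists (Ordinal jn); rewrite ?inE.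
by rewrite inE => ->; rewrite ltn_ord.
Qed.

(** * Witnesses and join results *)

Lemma dig_surj (g : nat -> nat) r : (forall i, i < r -> g i < N) ->
  exists2 x, x < N ^ r & forall i, i < r -> dig i x = g i.
Proof.
elim: r g => [|r IH] g gN; first by exists 0; rewrite ?expn0.
have [x xN xg] := IH (fun i => g i.+1) (fun i ir => gN i.+1 ir).
have g0 := gN 0 isT; have N0 : 0 < N by apply: leq_ltn_trans g0.
exists (g 0 + N * x).
  rewrite expnS; apply: leq_trans (_ : N * x.+1 <= _); last by rewrite leq_mul2l xN orbT.
  by rewrite mulnS ltn_add2r.
case=> [_|i ir]; rewrite /dig; first by rewrite expn0 divn1 addnC mulnC modnMDl modn_small.
have -> : (g 0 + N * x) %/ N ^ i.+1 = x %/ N ^ i; last exact: xg.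
by rewrite expnS divnMA addnC (mulnC N) divnMDl // (divn_small g0) addn0.
Qed.

Lemma dig_inj r x y : x < N ^ r -> y < N ^ r ->
  (forall i, i < r -> dig i x = dig i y) -> x = y.
Proof.
elim: r x y => [|r IH] x y; first by rewrite expn0 !ltnS !leqn0 => /eqP -> /eqP ->.
rewrite expnS => xN yN xy.
have N0 : 0 < N by case: (posnP N) xN => // ->.
rewrite (divn_eq x N) (divn_eq y N); have := xy 0 isT.
rewrite /dig expn0 !divn1 => ->; congr (_ * _ + _).
apply: IH; try by rewrite ltn_divLR // mulnC.
by move=> i ir; have := xy i.+1 ir; rewrite /dig expnS !divnMA.
Qed.

Hypothesis s_uniq : uniq s.
Hypothesis s_wf : forall f, f \in s -> wf_fact schema f.
Hypothesis head_sub : head \subset attrQ schema.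
Hypothesis attrQ_B : attrQ schema :\: head = [set B].

Let avals x (k : 'I_a) := aval k x.

Lemma rho_in k : k \in attrQ schema -> k \in schema (rho k).
Proof.
move=> /bigcupP[i _ ki]; rewrite /rho; case: pickP => //= /(_ i).
by rewrite ki.
Qed.

Lemma schema_attrQ i k : k \in schema i -> k \in attrQ schema.
Proof. by move=> ki; apply/bigcupP; exists i. Qed.

Lemma attrQ_cases k : k \in attrQ schema -> k != B -> k \in head.
Proof.
move=> kQ kB; apply: contraNT kB => kh.
by have := in_set1 k B; rewrite -attrQ_B inE kh kQ => <-.
Qed.

(** By [wf_fact] a fact vanishes outside its schema, so its values on the schema determine it. *)
Lemma valid_fact x (i : 'I_m) : x < n -> validb x -> fct (dig i x) = (i, restrict (schema i) (avals x)).
Proof.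
move=> xn /allP/(_ i); rewrite mem_enum => /(_ isT) /andP[/eqP ri /allP ai].
have dN := dig_lt i xn; have fs : fct (dig i x) \in s by apply: mem_nth.
have e1 : (fct (dig i x)).1 = i by apply/val_inj; rewrite /= -fld_rel.
have wf := s_wf fs; rewrite [LHS]surjective_pairing; congr pair => //.
apply/ffunP => k; rewrite ffunE; case: ifPn => ki; last by rewrite wf // e1.
by rewrite /avals -(eqP (ai k _)) ?mem_enum // fld_attr.
Qed.

Lemma fact_valid x (v : 'I_a -> nat) : x < n ->
  (forall i : 'I_m, fct (dig i x) = (i, restrict (schema i) v)) ->
  validb x /\ forall k, k \in attrQ schema -> aval k x = v k.
Proof.
move=> xn xv.
have av k : k \in attrQ schema -> aval k x = v k.
  by move=> kQ; rewrite /aval fld_attr ?dig_lt // xv /= ffunE rho_in.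
split=> //; apply/allP => i _; rewrite fld_rel ?dig_lt // xv eqxx /=.
apply/allP => k; rewrite mem_enum => ki.
by rewrite fld_attr ?dig_lt // xv /= ffunE ki av // (schema_attrQ ki).
Qed.

Lemma witness (v : 'I_a -> nat) : (forall i, (i, restrict (schema i) v) \in s) ->
  exists x : 'I_n, forall i : 'I_m, fct (dig i x) = (i, restrict (schema i) v).
Proof.
(* The digit of a relation is the position of its fact in [s]; the value 0 fills in for numbers that
   are no relation symbol. *)
move=> vs; pose g j := if insub j is Some i then index (i : 'I_m, restrict (schema i) v) s else 0.
have gE (i : 'I_m) : g i = index (i, restrict (schema i) v) s by rewrite /g valK.
have [|x xn xg] := @dig_surj g m.
  by move=> j jm; rewrite (gE (Ordinal jm)) index_mem.
by exists (Ordinal xn) => i; rewrite /fct /= xg // gE nth_index.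
Qed.

Lemma fct_inj j j' : j < N -> j' < N -> fct j = fct j' -> j = j'.
Proof. by move=> jN jN' /eqP; rewrite nth_uniq // => /eqP. Qed.

Lemma same_equiv : equivalence_rel sO.
Proof.
move=> x y z; split; first by apply/allP => k _.
by move=> /allP xy; apply: eq_in_all => k kh; rewrite (eqP (xy k kh)).
Qed.

Lemma card_uses l (x : 'I_n) : #|uses l x| <= size l.
Proof.
elim: l => [|i l IH]; first by rewrite leqn0 cards_eq0; apply/eqP/setP => j; rewrite !inE.
have -> : uses (i :: l) x = [set j : 'I_n | dig i x == j] :|: uses l x.
  by apply/setP => j; rewrite !inE.
apply: leq_trans (leq_card_setU _ _) _; rewrite /= -add1n leq_add //.
by apply/card_le1P => j; rewrite inE => /eqP jE k; rewrite !inE jE -val_eqE eq_sym.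
Qed.

Lemma card_usesB (x : 'I_n) : #|uses IB x| <= m.
Proof.
apply: leq_trans (card_uses _ _) _; rewrite size_filter.
by apply: leq_trans (count_size _ _) _; rewrite size_enum_ord.
Qed.

(** All attributes but B are in the head, so two witnesses of one answer can differ only in B. In
    particular they share their facts without B. *)
Lemma same_restrict (x y : 'I_n) i : sO x y -> (B \in schema i -> bO x = bO y) ->
  restrict (schema i) (avals x) = restrict (schema i) (avals y).
Proof.
move=> /allP xy bxy; apply/ffunP => k; rewrite !ffunE; case: ifP => // ki.
have [kB|kB] := eqVneq k B; first by subst k; exact: bxy.
by apply/eqP/xy; rewrite mem_enum attrQ_cases // (schema_attrQ ki).
Qed.

(** This discharges [bv_inj]: the two witnesses select equal facts, and [uniq s] turns equal facts
    into equal digits. *)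
Lemma bO_inj (x y : 'I_n) : vO x -> vO y -> sO x y -> bO x = bO y -> x = y.
Proof.
move=> vx vy sxy bxy; apply/val_inj/(@dig_inj m); rewrite ?ltn_ord // => j jm.
apply: fct_inj; try by apply: dig_lt; exact: ltn_ord.
rewrite [LHS](valid_fact (Ordinal jm) (ltn_ord x) vx).
rewrite [RHS](valid_fact (Ordinal jm) (ltn_ord y) vy).
by rewrite (same_restrict sxy).
Qed.

(** This discharges [FB_bv]: a fact of a relation with B carries the value of B itself. *)
Lemma uses_bO (x y j : 'I_n) : vO x -> vO y -> j \in uses IB x -> j \in uses IB y -> bO x = bO y.
Proof.
move=> vx vy; rewrite !inE => /hasP[i + /eqP ix] /hasP[i' _ /eqP iy].
rewrite mem_filter => /andP[Bi _]; have := valid_fact i (ltn_ord x) vx.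
rewrite ix -iy (valid_fact i' (ltn_ord y) vy) => -[-> /ffunP/(_ B)].
by rewrite !ffunE Bi => /esym.
Qed.

Lemma wit_of_db (D : seq (fact a m)) (v : 'I_a -> nat) : {subset D <= s} ->
  (forall i, (i, restrict (schema i) v) \in D) ->
  exists x : 'I_n, [/\ vO x, forall k, k \in attrQ schema -> aval k x = v k
    & forall i : 'I_m, fct (dig i x) \in D].
Proof.
move=> Ds vD; have [x xv] := witness (fun i => Ds _ (vD i)).
have [vx av] := fact_valid (ltn_ord x) xv.
by exists x; split=> // i; rewrite xv.
Qed.

(** * The output database and its size *)

Let out_db out : seq (fact a m) := pmap (fun j => nth None (map Some s) j) out.

Lemma mem_out_db out f : (f \in out_db out) -> exists2 j, j \in out & j < N /\ f = fct j.
Proof.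
rewrite mem_pmap => /mapP[j jo]; have [jN|Nj] := ltnP j N.
  by rewrite (nth_map f0) // => -[->]; exists j.
by rewrite nth_default ?size_map.
Qed.

Lemma out_db_mem out j : j \in out -> j < N -> fct j \in out_db out.
Proof.
by move=> jo jN; rewrite mem_pmap; apply/mapP; exists j => //; rewrite (nth_map f0).
Qed.

Let used := G :|: forced.
Variable out : seq nat.
Hypothesis outP : forall j, (j \in out) = (j < N) && (j \in [seq val t | t in used]).

Lemma out_same : same_answers schema head (out_db out) s.
Proof.
move=> t; split=> -[t0 [v [vt vD]]]; split=> //.
  exists v; split=> // i; have [j _ [jN ->]] := mem_out_db (vD i); exact: mem_nth.
have [x [vx xv _]] := wit_of_db (fun f h => h) vD.
(* The witness [x] itself may be lost; [y] yields the same answer, with its B-facts in [G] and its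
   other facts in [forced]. *)
have /existsP[y /and3P[vy sxy yG]] : cov vO sO (uses IB) G x.
  apply: (greedy_cov same_equiv uses_bO) => //; rewrite ?card_ord //.
  by move=> z _; apply: image_f.
exists (avals y); split=> [k kh|i].
  rewrite -vt // -xv ?(subsetP head_sub) //.
  by have /allP/(_ k) := sxy; rewrite mem_enum => /(_ kh) /eqP ->.
rewrite -(valid_fact i (ltn_ord y) vy); apply: out_db_mem; rewrite ?dig_lt //.
rewrite outP dig_lt //=; apply/imageP.
exists (Ordinal (dig_ltn i (ltn_ord y))) => //; rewrite inE.
have [Bi|Bi] := boolP (B \in schema i).
  rewrite (subsetP yG) // inE; apply/hasP; exists i => //.
  by rewrite mem_filter Bi mem_enum.
rewrite orbC inE; apply/orP; left; apply/existsP; exists y; rewrite [validb y]vy inE.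
by apply/hasP; exists i; rewrite // mem_filter Bi mem_enum.
Qed.

Lemma out_size (Dstar : seq (fact a m)) : uniq out -> uniq Dstar -> {subset Dstar <= s} ->
  same_answers schema head Dstar s ->
  size (undup (out_db out)) <= (2 * m * m).+1 * (trunc_log 2 N).+1 * size Dstar.
Proof.
move=> uo uD Ds same.
have opt x : vO x -> exists y : 'I_n, [/\ vO y, sO x y & forall i : 'I_m, fct (dig i y) \in Dstar].
  move=> vx; have : answer schema head s (restrict head (avals x)).
    split=> [k kh|]; first by rewrite ffunE (negbTE kh).
    exists (avals x); split=> [k kh|i]; first by rewrite ffunE kh.
    by rewrite -(valid_fact i (ltn_ord x) vx) mem_nth // dig_lt.
  move=> /same[_ [v [vt vD]]]; have [y [vy yv yD]] := wit_of_db Ds vD.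
  exists y; split=> //; apply/allP => k; rewrite mem_enum => kh.
  by rewrite yv ?(subsetP head_sub) // vt // ffunE kh.
(* The optimum is split by whether a fact mentions B: [S] pays for [G], and [S'] for the forced
   facts. *)
pose S := [set j : 'I_n | [&& j < N, fct j \in Dstar & B \in schema (fct j).1]].
pose S' := [set j : 'I_n | [&& j < N, fct j \in Dstar & B \notin schema (fct j).1]].
have Scov x : vO x -> cov vO sO (uses IB) S x.
  move=> vx; have [y [vy sxy yD]] := opt x vx; apply/existsP; exists y.
  rewrite vy sxy /=; apply/subsetP => j; rewrite !inE => /hasP[i + /eqP ij].
  rewrite mem_filter => /andP[Bi _]; rewrite -ij dig_lt // yD /=.
  by rewrite (valid_fact i (ltn_ord y) vy).
(* A fact without B is determined by the answer, so the witness of that answer inside [Dstar] uses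
   the very same fact. *)
have forcedS : forced \subset S'.
  apply/subsetP => j; rewrite inE => /existsP[x /andP[vx]]; rewrite inE => /hasP[i + /eqP ij].
  rewrite mem_filter => /andP[Bi _]; have [y [vy sxy yD]] := opt x vx.
  rewrite inE -ij dig_lt //; have := yD i.
  rewrite (valid_fact i (ltn_ord y) vy) (valid_fact i (ltn_ord x) vx) /= Bi andbT.
  by rewrite (same_restrict sxy) // => Bi'; rewrite Bi' in Bi.
have SS : #|S| + #|S'| <= size Dstar.
  rewrite -cardsUI (_ : S :&: S' = set0) ?cards0 ?addn0; last first.
    by apply/setP => j; rewrite !inE; case: (B \in _); rewrite ?andbF.
  rewrite cardE -(size_map (fun j : 'I_n => fct j)); apply: uniq_leq_size.
    rewrite map_inj_in_uniq ?enum_uniq // => j j'; rewrite !mem_enum !inE.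
    have h (b b1 b2 : bool) : [&& b, b1 & b2] || [&& b, b1 & ~~ b2] -> b by case: b.
    by move=> /h jN /h jN' /(fct_inj jN jN') /val_inj.
  move=> f /mapP[j]; rewrite mem_enum !inE => jS ->.
  by case/orP: jS => /and3P[].
have m0 : 0 < m by case: m i0 => [[]|].
(* This fixes the number of dyadic blocks in [greedy_card]. *)
have nk : n < 2 ^ (m * (trunc_log 2 N).+1).
  by rewrite mulnC expnM /n ltn_exp2r // trunc_log_ltn.
have Gc : #|G| <= 2 * m * (m * (trunc_log 2 N).+1) * #|S|.
  apply: (greedy_card same_equiv card_usesB bO_inj uses_bO) => //; rewrite ?card_ord //.
  by move=> z _; apply: image_f.
have oc : size (undup (out_db out)) <= #|used|.
  apply: leq_trans (size_undup _) _; rewrite size_pmap.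
  apply: leq_trans (count_size _ _) _; rewrite cardE -(size_map val); apply: uniq_leq_size => // j.
  by rewrite outP => /andP[].
apply: leq_trans oc _; apply: leq_trans (leq_card_setU _ _) _.
apply: leq_trans (leq_add Gc (subset_leq_card forcedS)) _.
apply: leq_trans (_ : (2 * m * m).+1 * (trunc_log 2 N).+1 * (#|S| + #|S'|) <= _); last first.
  by rewrite leq_mul2l SS orbT.
move: #|S| #|S'| (trunc_log 2 N) => p q t.
rewrite mulnDr; apply: leq_add.
  by rewrite leq_mul2r; apply/orP; right; rewrite mulnA leq_mul2r leqnSn orbT.
by rewrite leq_pmull.
Qed.

End Run.
End Program.

Theorem theorem33 :
  forall (a m : nat) (schema : 'I_m -> {set 'I_a}) (head : {set 'I_a}),
    head \subset attrQ schema ->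
    connectedQ schema ->
    #|attrQ schema :\: head| = 1 ->
    (* SWP(Q, .) is O(log N)-approximable: there is a program of the RAM,
       running in time polynomial in N = |D|, ... *)
    exists (P : seq instr) (d k c : nat),
      forall s : seq (fact a m),
        uniq s ->
        (forall f, f \in s -> wf_fact schema f) ->
        let N := size s in
        let cf := run P (d * N.+1 ^ k) (init_config s) in
        halted P cf /\
        all (fun j => j < N) (out_indices cf) /\
        let D' := output_db s cf in
        same_answers schema head D' s /\
        (forall Dstar : seq (fact a m),
           uniq Dstar -> {subset Dstar <= s} ->
           same_answers schema head Dstar s ->
           size (undup D') <= c * (trunc_log 2 N).+1 * size Dstar).
Proof.
move=> a m schema head head_sub _ /eqP/cards1P[B attrQ_B].
have [i0 _ _] : exists2 i : 'I_m, true & B \in schema i.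
  have : B \in attrQ schema :\: head by rewrite attrQ_B set11.
  by rewrite inE => /andP[_ /bigcupP[i _ Bi]]; exists i.
have [d [k h]] := prog_poly m (Main schema head B i0).
(* In the ratio, [2 * m] is [2 * p] with rank bound [p = m], the other [m] comes from the logarithm
   of N ^ m, and the successor pays for the forced facts. *)
exists (prog (epow m) (Main schema head B i0)), d, k, (2 * m * m).+1.
move=> s s_uniq s_wf N cf; have [hcf memE] := h (encode s) N erefl.
have [uo outP] := exec_main schema head B i0 s.
have outE : out_indices cf = [seq exec (N ^ m) (fun=> 0) (encode s) (Main schema head B i0) i.+1
    | i <- iota 0 (exec (N ^ m) (fun=> 0) (encode s) (Main schema head B i0) 0)].
  by rewrite /out_indices memE.
split=> //; split; last split.
- by apply/allP => j; rewrite outE outP => /andP[].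
- by rewrite /output_db outE; apply: out_same outP.
- move=> Dstar uD Ds same; rewrite /output_db outE; exact: (out_size _ _ _ _ outP).
Qed.
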